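(* Let $(M,\omega,\mathbb{T})$ be a compact symplectic toric manifold of real dimension $2m$, let $J_0\in K_\omega^{\mathbb{T}}(M)$ with matrix $S$ in its momentum-angle coordinates, let $C$ be a constant antisymmetric $m\times m$ matrix, and let $J_t\in DGK_\omega^{\mathbb{T}}(M)$ ($|t|$ small) be the deformation of $J_0$ whose restriction to $\mathring M$ is $$\sum_{i,j=1}^m\Psi_{ij}(t)\frac{\partial}{\partial t^i}\otimes d\mu^j-\sum_{i,j=1}^m(\Psi(t)^{-1})_{ij}\frac{\partial}{\partial\mu^i}\otimes dt^j,\qquad\Psi(t)=S+tC.$$ Then the Kodaira-Spencer class of the deformation $J_t$ is $[\sigma\omega]\in H^{0,1}(M,T^{1,0})$, where $\sigma$ is the holomorphic Poisson structure on $(M,J_0)$ given by $$\sigma=2\sum_{j,k=1}^mC_{jk}\,K_j^{1,0}\otimes K_k^{1,0}.$$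
   Context: Toric setting. $M$ is compact connected, $\mathbb{T}$ is an $m$-torus with Lie algebra $\mathfrak{t}$ acting effectively and in a hamiltonian fashion on $(M,\omega)$ with moment map $\mu:M\to\mathfrak{t}^*$; $\Delta=\mu(M)$, $\mathring M=\mu^{-1}(\mathring\Delta)$ (dense, open). A basis $(\xi_j)$ of $\mathfrak{t}$ is fixed, $K_j=\xi_j^\sharp$ is the induced vector field on $M$, $\mu^j=\langle\mu,\xi_j\rangle$, $\omega(K_j,\cdot)=-d\mu^j$. $K_j^{1,0}=\frac12(K_j-iJ_0K_j)$. Structures. $J^{*_\omega}$ is defined by $\omega(JX,Y)=\omega(X,J^{*_\omega}Y)$. $GK_\omega^{\mathbb{T}}(M)$ is the set of $\mathbb{T}$-invariant almost complex structures $J$ with $\omega(X,JX)>0$ for $X\ne0$ and $J$, $J^{*_\omega}$ both integrable; $K_\omega^{\mathbb{T}}(M)$ is the subset with $J^{*_\omega}=-J$; with $\mathcal{K}$ the span of the $K_j$ on $\mathring M$, $DGK_\omega^{\mathbb{T}}(M)=\{J\in GK_\omega^{\mathbb{T}}(M):J^{*_\omega}\mathcal{K}=J\mathcal{K}\text{ on }\mathring M\}$. Momentum-angle coordinates of $J_0$: local $J_0$-holomorphic coordinates $z^j=u^j+it^j$ on $\mathring M$ with $\partial/\partial u^j=-J_0K_j$, $\partial/\partial t^j=K_j$; replacing $u^j$ by $\mu^j$ gives $(\mu^j,t^j)$ with $\omega=\sum_jd\mu^j\wedge dt^j$ and $J_0=\sum S_{ij}\frac{\partial}{\partial t^i}\otimes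 d\mu^j-\sum(S^{-1})_{ij}\frac{\partial}{\partial\mu^i}\otimes dt^j$, with $S$ symmetric positive definite. For each such $C$ the family in the claim does extend to elements $J_t\in DGK_\omega^{\mathbb{T}}(M)$ for $|t|$ sufficiently small. Conventions. If in local $J_0$-holomorphic coordinates $\left.\frac{d}{dt}\right|_{t=0}J_t\frac{\partial}{\partial\bar z^j}=\sum_k\left(\alpha_{\bar jk}\frac{\partial}{\partial z^k}+\beta_{\bar j\bar k}\frac{\partial}{\partial\bar z^k}\right)$, the Kodaira-Spencer class of $J_t$ is the class represented by $\sum_{j,k}\alpha_{\bar jk}\,d\bar z^j\otimes\frac{\partial}{\partial z^k}$. If $\sigma=\sum_{k,\ell}\sigma^{k\ell}\frac{\partial}{\partial z^k}\otimes\frac{\partial}{\partial z^\ell}$ and $\omega=\sum_{k,\ell}\omega_{k\bar\ell}\,dz^k\wedge d\bar z^\ell$ (viewed as the map $T^{0,1}\to\Lambda^{1,0}$ given by $\sum\omega_{k\bar\ell}\,dz^k\otimes d\bar z^\ell$), then $[\sigma\omega]$ is the class of $\sum_{j,k,\ell}\omega_{\ell\bar j}\sigma^{\ell k}\,d\bar z^j\otimes\frac{\partial}{\partial z^k}\in\Omega^{0,1}(M,T^{1,0})$. *)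

(* Defs.v *)
From HB Require Import structures.
From mathcomp Require Import all_boot all_order all_algebra.
From mathcomp Require Import boolp classical_sets reals topology normedtype derive.
From mathcomp Require Import complex ring.

Set Implicit Arguments.
Unset Strict Implicit.
Unset Printing Implicit Defensive.

Import Order.TTheory GRing.Theory Num.Theory.
Import numFieldNormedType.Exports.

Local Open Scope classical_set_scope.
Local Open Scope ring_scope.

(* Points of R^n are row vectors, tangent vectors in a chart are column       *)
(* vectors of components.                                                     *)

Section Smooth.
Variables (R : realType) (n : nat).

Definition ebase (b : 'I_n) : 'rV[R]_n := delta_mx 0 b.

Fixpoint Ck (k : nat) (U : set 'rV[R]_n) (f : 'rV[R]_n -> R) : Prop :=
  (forall x, U x -> {for x, continuous f}) /\
  if k is k'.+1 then
    forall b, (forall x, U x -> derivable f x (ebase b)) /\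
              Ck k' U (fun x => 'D_(ebase b) f x)
  else True.

Definition smooth_on (U : set 'rV[R]_n) (f : 'rV[R]_n -> R) : Prop :=
  open U /\ forall k, Ck k U f.

End Smooth.

Section Manifold.
Variable R : realType.

(* [coord] is meaningful on [dom] only, [pt] on [cod] only.                   *)
Record chart (M : Type) (n : nat) := Chart {
  dom : set M;
  coord : M -> 'rV[R]_n;
  pt : 'rV[R]_n -> M }.

Definition cod (M : Type) (n : nat) (c : chart M n) : set 'rV[R]_n :=
  coord c @` dom c.

Definition is_chart (M : topologicalType) (n : nat) (c : chart M n) : Prop :=
  [/\ open (dom c), open (cod c),
      (forall p, dom c p -> pt c (coord c p) = p),
      (forall p, dom c p -> {for p, continuous (coord c)}) &
      (forall x, cod c x -> {for x, continuous (pt c)})].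

Definition smooth_transition (M : Type) (n : nat) (c c' : chart M n) : Prop :=
  forall a, smooth_on (coord c @` (dom c `&` dom c'))
                      (fun x => coord c' (pt c x) 0 a).

Record smoothManifold (n : nat) := SmoothManifold {
  man_sort :> topologicalType;
  atlas : set (chart man_sort n);
  man_hausdorff : hausdorff_space man_sort;
  man_countable : @second_countable man_sort;
  atlas_chart : forall c, atlas c -> is_chart c;
  atlas_cover : forall p, exists2 c, atlas c & dom c p;
  atlas_smooth : forall c c', atlas c -> atlas c' -> smooth_transition c c';
  atlas_max : forall c, is_chart c ->
    (forall c', atlas c' -> smooth_transition c c' /\ smooth_transition c' c) ->
    atlas c }.

(* A field of real square matrices given by its components in every chart;    *)
(* only the values at points of the domain of a chart of the atlas matter.    *)
Definition tensor (n : nat) (M : smoothManifold n) :=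
  chart M n -> M -> 'M[R]_n.

Section Tensors.
Variables (n : nat) (M : smoothManifold n).
Implicit Types (c : chart M n) (p : M) (T w J : tensor M).

(* The matrix at [p] of the differential of [f] in the charts [c] (at [p])    *)
(* and [c'] (at [f p]).                                                       *)
Definition dmap (f : M -> M) c c' p : 'M[R]_n :=
  \matrix_(a, b) 'D_(ebase R b) (fun x => coord c' (f (pt c x)) 0 a) (coord c p).

Definition dfun (f : M -> R) c p : 'rV[R]_n :=
  \row_b 'D_(ebase R b) (f \o pt c) (coord c p).

Definition smooth_tensor T : Prop :=
  forall c, atlas c -> forall a b, smooth_on (cod c) (fun x => T c (pt c x) a b).

(* f_* preserves the (1,1)-tensor, resp. f^* preserves the 2-form; the case   *)
(* f = id is the transformation rule under a change of charts.                *)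
Definition preserves_endo (f : M -> M) T : Prop :=
  forall c c' p, atlas c -> atlas c' -> dom c p -> dom c' (f p) ->
    T c' (f p) *m dmap f c c' p = dmap f c c' p *m T c p.

Definition preserves_form (f : M -> M) w : Prop :=
  forall c c' p, atlas c -> atlas c' -> dom c p -> dom c' (f p) ->
    w c p = (dmap f c c' p)^T *m w c' (f p) *m dmap f c c' p.

(* [J c p] has entries J^a_b, i.e. J d_b = \sum_a J^a_b d_a.                  *)
Definition endo_field J : Prop := smooth_tensor J /\ preserves_endo id J.

(* [w c p] has entries w(d_a, d_b), so that w(X, Y) = X^T w Y.                *)
Definition symplectic_form w : Prop :=
  [/\ smooth_tensor w, preserves_form id w,
      (forall c p, atlas c -> dom c p ->
         (w c p)^T = - w c p /\ w c p \in unitmx) &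
      (forall c p (i j k : 'I_n), atlas c -> dom c p ->
         let W a b x := w c (pt c x) a b in
         'D_(ebase R i) (W j k) (coord c p) + 'D_(ebase R j) (W k i) (coord c p)
         + 'D_(ebase R k) (W i j) (coord c p) = 0)].

Definition almost_complex J : Prop :=
  endo_field J /\
  (forall c p, atlas c -> dom c p -> J c p *m J c p = - 1%:M).

(* The matrix J* with w(J X, Y) = w(X, J* Y), see [omega_adjP].               *)
Definition omega_adj w J : tensor M :=
  fun c p => invmx (w c p) *m (J c p)^T *m w c p.

Lemma omega_adjP w J c p (X Y : 'cV[R]_n) : w c p \in unitmx ->
  (J c p *m X)^T *m w c p *m Y = X^T *m w c p *m (omega_adj w J c p *m Y).
Proof.
move=> wu; rewrite /omega_adj trmx_mul -!mulmxA.
by rewrite [w c p *m (invmx _ *m _)]mulmxA mulmxV // mul1mx.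
Qed.

End Tensors.

(* Complex coordinates z^j = u^j + i t^j on R^(m + m), the u's coming first.  *)

Section Complex.
Variables (m : nat) (M : smoothManifold (m + m)).
Implicit Types (c : chart M (m + m)) (p : M) (J : tensor M).
Local Notation C := (R[i]).

Definition std_cplx : 'M[R]_(m + m) := block_mx 0 (- 1%:M) 1%:M 0.

Definition holo_chart J c : Prop :=
  atlas c /\ forall p, dom c p -> J c p = std_cplx.

Definition integrable J : Prop :=
  forall p, exists2 c, holo_chart J c & dom c p.

Definition toC k l (A : 'M[R]_(k, l)) : 'M[C]_(k, l) :=
  map_mx (fun x => x%:C%C) A.

(* d/dz^j = (d/du^j - i d/dt^j) / 2 and its conjugate, as complexified        *)
(* vectors, and the components of a complexified vector along them.           *)
Definition ddz (j : 'I_m) : 'cV[C]_(m + m) :=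
  2^-1 *: (delta_mx (lshift m j) 0 - 'i%C *: delta_mx (rshift m j) 0).
Definition ddzb (j : 'I_m) : 'cV[C]_(m + m) :=
  2^-1 *: (delta_mx (lshift m j) 0 + 'i%C *: delta_mx (rshift m j) 0).
Definition dz (k : 'I_m) (v : 'cV[C]_(m + m)) : C :=
  v (lshift m k) 0 + 'i%C * v (rshift m k) 0.
Definition dzb (k : 'I_m) (v : 'cV[C]_(m + m)) : C :=
  v (lshift m k) 0 - 'i%C * v (rshift m k) 0.

Lemma dz_expand (v : 'cV[C]_(m + m)) :
  v = \sum_k (dz k v *: ddz k + dzb k v *: ddzb k).
Proof.
have i2 : ('i%C : C) * 'i%C = - 1 by rewrite -expr2 sqr_i.
have E k : dz k v *: ddz k + dzb k v *: ddzb k =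
    v (lshift m k) 0 *: delta_mx (lshift m k) 0 +
    v (rshift m k) 0 *: delta_mx (rshift m k) 0.
  apply/colP => x; rewrite /dz /dzb !mxE.
  move: (_ && _)%:R (_ && _)%:R (v _ _) (v _ _) => t s z y.
  have -> : z * t = - ('i%C * 'i%C * (z * t)) by rewrite i2 mulN1r opprK.
  by field.
under eq_bigr do rewrite E.
apply/colP => x; rewrite summxE.
case: (split_ordP x) => y ->; rewrite (bigD1 y) //= big1 => [|k /negPf ky].
- by rewrite !mxE !eqxx eq_lrshift /= mulr1 mulr0 !addr0.
- by rewrite !mxE eq_lshift eq_lrshift eq_sym ky !mulr0 addr0.
- by rewrite !mxE !eqxx eq_rlshift /= mulr1 mulr0 add0r addr0.
- by rewrite !mxE eq_rshift eq_rlshift eq_sym ky !mulr0 addr0.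
Qed.

Definition dirC (v : 'rV[R]_(m + m)) (f : 'rV[R]_(m + m) -> C) x : C :=
  Complex ('D_v (fun y => complex.Re (f y)) x)
          ('D_v (fun y => complex.Im (f y)) x).

Definition wirt (j : 'I_m) (f : 'rV[R]_(m + m) -> C) x : C :=
  2^-1 * (dirC (ebase R (lshift m j)) f x - 'i%C * dirC (ebase R (rshift m j)) f x).
Definition wirtb (j : 'I_m) (f : 'rV[R]_(m + m) -> C) x : C :=
  2^-1 * (dirC (ebase R (lshift m j)) f x + 'i%C * dirC (ebase R (rshift m j)) f x).

Definition smoothC_on (U : set 'rV[R]_(m + m)) (f : 'rV[R]_(m + m) -> C) : Prop :=
  smooth_on U (fun y => complex.Re (f y)) /\
  smooth_on U (fun y => complex.Im (f y)).

Definition zcoord c (k : 'I_m) p : C :=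
  Complex (coord c p 0 (lshift m k)) (coord c p 0 (rshift m k)).

(* The holomorphic Jacobian, with entries d z'^k / d z^l.                     *)
Definition holo_jac c c' p : 'M[C]_m :=
  \matrix_(k, l) wirt l (fun x => zcoord c' k (pt c x)) (coord c p).

(* Complex m x m (resp. 1 x m) components in every holomorphic chart.         *)
Definition ctensor := chart M (m + m) -> M -> 'M[C]_m.
Definition cvector := chart M (m + m) -> M -> 'rV[C]_m.

(* Smooth sections \sum_k v^k d/dz^k of T^{1,0}.                              *)
Definition section10 J (v : cvector) : Prop :=
  (forall c, holo_chart J c ->
     forall k, smoothC_on (cod c) (fun x => v c (pt c x) 0 k)) /\
  (forall c c' p, holo_chart J c -> holo_chart J c' -> dom c p -> dom c' p ->
     v c' p = v c p *m (holo_jac c c' p)^T).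

(* Smooth (0,1)-forms \sum_{j,k} a_{jk} dzbar^j (x) d/dz^k valued in T^{1,0}. *)
Definition form01 J (a : ctensor) : Prop :=
  (forall c, holo_chart J c ->
     forall j k, smoothC_on (cod c) (fun x => a c (pt c x) j k)) /\
  (forall c c' p, holo_chart J c -> holo_chart J c' -> dom c p -> dom c' p ->
     (map_mx conjc (holo_jac c c' p))^T *m a c' p =
     a c p *m (holo_jac c c' p)^T).

Definition dbar_section (v : cvector) : ctensor := fun c p =>
  \matrix_(j, k) wirtb j (fun x => v c (pt c x) 0 k) (coord c p).

Definition dbar_closed J (a : ctensor) : Prop :=
  forall c p (j k l : 'I_m), holo_chart J c -> dom c p ->
    wirtb l (fun x => a c (pt c x) j k) (coord c p) =
    wirtb j (fun x => a c (pt c x) l k) (coord c p).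

Definition cocycle01 J : set ctensor := [set a | form01 J a /\ dbar_closed J a].

(* The class of [a] in H^{0,1}(M, T^{1,0}), as a coset of the dbar-exact      *)
(* forms.                                                                     *)
Definition dolbeault_class J (a : ctensor) : set ctensor :=
  [set b | cocycle01 J b /\ exists2 v, section10 J v &
     forall c p, holo_chart J c -> dom c p -> b c p = a c p + dbar_section v c p].

(* Bivectors \sum_{k,l} s^{kl} d/dz^k (x) d/dz^l; the last clause is the      *)
(* vanishing of the Schouten bracket [s, s].                                  *)
Definition holomorphic_poisson J (s : ctensor) : Prop :=
  [/\ (forall c, holo_chart J c -> forall k l,
         smoothC_on (cod c) (fun x => s c (pt c x) k l)),
      (forall c c' p, holo_chart J c -> holo_chart J c' -> dom c p -> dom c' p ->
         s c' p = holo_jac c c' p *m s c p *m (holo_jac c c' p)^T),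
      (forall c p, holo_chart J c -> dom c p -> (s c p)^T = - s c p),
      (forall c p j k l, holo_chart J c -> dom c p ->
         wirtb j (fun x => s c (pt c x) k l) (coord c p) = 0) &
      (forall c p (i j k : 'I_m), holo_chart J c -> dom c p ->
         let D l a b := wirt l (fun x => s c (pt c x) a b) (coord c p) in
         \sum_l (s c p i l * D l j k + s c p j l * D l k i
                 + s c p k l * D l i j) = 0)].

(* w_{k lbar} = w(d/dz^k, d/dzbar^l), where                                   *)
(* (a /\ b)(X, Y) = a(X) b(Y) - a(Y) b(X).                                    *)
Definition form11 (w : tensor M) : ctensor := fun c p =>
  \matrix_(k, l) ((ddz k)^T *m toC (w c p) *m ddzb l) 0 0.

Definition contract (s : ctensor) (w : tensor M) : ctensor := fun c p =>
  \matrix_(j, k) \sum_l form11 w c p l j * s c p l k.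

Definition tderiv (J : R -> tensor M) : tensor M := fun c p =>
  \matrix_(a, b) derive1 (fun t => J t c p a b) 0.

Definition ks_form (J : R -> tensor M) : ctensor := fun c p =>
  \matrix_(j, k) dz k (toC (tderiv J c p) *m ddzb j).

Definition smooth_family (e : R) (J : R -> tensor M) : Prop :=
  forall c, atlas c -> forall a b,
    smooth_on [set y : 'rV[R]_(1 + (m + m)) |
                 `|lsubmx y 0 0| < e /\ cod c (rsubmx y)]
      (fun y => J (lsubmx y 0 0) c (pt c (rsubmx y)) a b).

End Complex.

(* The torus is R^m / Z^m, with Lie algebra R^m and dual R^m: [act s] is the  *)
(* action of exp s, and the exact kernel Z^m in [act_effective] says that the *)
(* action descends to the torus and is effective there.                       *)
Record toricManifold (m : nat) := ToricManifold {
  tor_man :> smoothManifold (m + m);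
  tor_compact : compact [set: tor_man];
  tor_connected : connected [set: tor_man];
  omega : tensor tor_man;
  omega_symplectic : symplectic_form omega;
  act : 'rV[R]_m -> tor_man -> tor_man;
  act0 : forall p, act 0 p = p;
  actD : forall s s' p, act (s + s') p = act s (act s' p);
  act_effective : forall s, (forall p, act s p = p) <->
    exists z : 'rV[int]_m, s = map_mx (fun k : int => k%:~R) z;
  act_smooth : forall c c', atlas c -> atlas c' -> forall a,
    smooth_on [set y : 'rV[R]_(m + (m + m)) |
                 cod c (rsubmx y) /\ dom c' (act (lsubmx y) (pt c (rsubmx y)))]
      (fun y => coord c' (act (lsubmx y) (pt c (rsubmx y))) 0 a);
  act_omega : forall s, preserves_form (act s) omega;
  mu : tor_man -> 'rV[R]_m;
  mu_smooth : forall c, atlas c -> forall i,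
    smooth_on (cod c) (fun x => mu (pt c x) 0 i);
  mu_act : forall s p, mu (act s p) = mu p;
  (* omega(s^#, .) = - d<mu, s>, where s^#(p) = d/dh act (h s) p at h = 0     *)
  mu_hamiltonian : forall (s : 'rV[R]_m) c p, atlas c -> dom c p ->
    (\col_a derive1 (fun h : R => coord c (act (h *: s) p) 0 a) 0)^T *m omega c p
    = - dfun (fun q => (mu q *m s^T) 0 0) c p }.

Section Toric.
Variables (m : nat) (X : toricManifold m).
Implicit Types (c z : chart X (m + m)) (p : X) (J : tensor X).

Definition Mring : set X := @mu m X @^-1` interior (range (@mu m X)).

(* The rows of [xi] are the basis (xi_j) of the Lie algebra.                  *)
Variable xi : 'M[R]_m.

Definition Kfield (j : 'I_m) c p : 'cV[R]_(m + m) :=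
  \col_a derive1 (fun h : R => coord c (act (h *: row j xi) p) 0 a) 0.

Definition muj (j : 'I_m) p : R := (mu p *m (row j xi)^T) 0 0.

Definition GK J : Prop :=
  [/\ almost_complex J,
      (forall s, preserves_endo (act s) J),
      (forall c p (v : 'cV[R]_(m + m)), atlas c -> dom c p -> v != 0 ->
         0 < (v^T *m omega c p *m (J c p *m v)) 0 0),
      integrable J &
      integrable (omega_adj (@omega m X) J)].

Definition KK J : Prop :=
  GK J /\ forall c p, atlas c -> dom c p ->
    omega_adj (@omega m X) J c p = - J c p.

(* Columns K_1, ..., K_m.                                                     *)
Definition Kmx c p : 'M[R]_(m + m, m) := \matrix_(a, j) Kfield j c p a 0.

Definition DGK J : Prop :=
  GK J /\ forall c p, atlas c -> dom c p -> Mring p ->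
    ((omega_adj (@omega m X) J c p *m Kmx c p)^T == (J c p *m Kmx c p)^T)%MS.

(* [z] is the chart (u, t) and [c] the chart (mu, t) on the same domain.      *)
Definition momentum_angle_chart J z c : Prop :=
  [/\ holo_chart J z /\ atlas c, dom z `<=` Mring /\ dom c = dom z,
      (forall p j, dom z p ->
         - (J z p *m Kfield j z p) = delta_mx (lshift m j) 0 /\
         Kfield j z p = delta_mx (rshift m j) 0) &
      (forall p j, dom z p ->
         coord c p 0 (lshift m j) = muj j p /\
         coord c p 0 (rshift m j) = coord z p 0 (rshift m j))].

(* \sum Psi_ij d/dt^i (x) dmu^j - \sum (Psi^-1)_ij d/dmu^i (x) dt^j           *)
Definition momentum_angle_tensor (Psi : 'M[R]_m) : 'M[R]_(m + m) :=
  block_mx 0 (- invmx Psi) Psi 0.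

(* In momentum-angle coordinates of [J 0] around each point of [Mring], the   *)
(* structure [J t] has matrix S + t C; for t = 0 this says that S is the      *)
(* matrix of [J 0].                                                           *)
Definition momentum_angle_deformation (e : R) (J : R -> tensor X)
    (S : X -> 'M[R]_m) (C : 'M[R]_m) : Prop :=
  forall p, Mring p -> exists z c,
    [/\ momentum_angle_chart (J 0) z c, dom c p &
        forall t q, `|t| < e -> dom c q ->
          J t c q = momentum_angle_tensor (S q + t *: C)].

Definition K10 J (j : 'I_m) c p : 'cV[R[i]]_(m + m) :=
  2^-1 *: (toC (Kfield j c p) - 'i%C *: toC (J c p *m Kfield j c p)).

(* The components of 2 \sum_{a,b} C_ab K_a^{1,0} (x) K_b^{1,0}.               *)
Definition sigma_of J (C : 'M[R]_m) : ctensor X := fun c p =>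
  \matrix_(k, l) (2 * \sum_a \sum_b
    (C a b)%:C%C * dz k (K10 J a c p) * dz l (K10 J b c p)).

End Toric.
End Manifold.

Arguments Mring {R m} X _.
Arguments omega {R m} t _ _.

(* Main.v *)
(* On [Mring], use the [J_0]-holomorphic coordinates [z = u + it] in which    *)
(* [K_j = d/dt^j], and let [P] be the matrix of [dmu/du]. Invariance of [mu]  *)
(* and [J_0] force [S P = 1], and [omega = dmu /\ dt] forces [P] symmetric.   *)
(* There the derivative of [J_t] at [0] has off-diagonal blocks [C P] and     *)
(* zero diagonal blocks, so the Kodaira-Spencer form is [- i P C], while      *)
(* [omega_(k lbar) = (i/2) P] and [sigma = - 2 C], whose contraction is       *)
(* [- i P C] too. Both forms are smooth tensors, so they agree on all of [M]  *)
(* by density of [Mring]: the classes agree because the forms do.             *)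
(* The vector fields [K_j^(1,0)] are holomorphic and commute because partial  *)
(* derivatives of the torus action in the time and space directions commute;  *)
(* hence [sigma] is holomorphic Poisson. Its contraction with [omega] is then *)
(* dbar-closed since [omega] is closed of type (1,1).                         *)

From HB Require Import structures.
Require Import Defs.
From mathcomp Require Import all_boot all_order all_algebra.
From mathcomp Require Import boolp classical_sets functions reals topology normedtype derive.
From mathcomp Require Import landau.
From mathcomp Require Import complex ring lra.
(* Otherwise [coord] would be the coordinate function of vector.v. *)
Import Defs.
Import Order.TTheory GRing.Theory Num.Theory.
Import numFieldNormedType.Exports.
Set Implicit Arguments.
Unset Strict Implicit.
Unset Printing Implicit Defensive.
Local Open Scope classical_set_scope.
Local Open Scope ring_scope.

(** * Differentiability and symmetry of second derivatives *)

(** The two classes coincide because the representing forms coincide ([ks_form_eq_contract]). Near a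
    point of [Mring] this is the matrix identity [momentum_angle_ks]: [momentum_angle_tderiv]
    computes the derivative of J_t in the holomorphic chart, [momentum_angle_omega] and
    [momentum_angle_sigma] compute omega and sigma there. Both forms obey the same transformation
    rule, so the identity passes to every holomorphic chart of J_0, and [dense_smoothC_eq] extends
    it beyond [Mring].

    That the forms are cocycles and sigma is Poisson rests on one analytic fact, the symmetry of
    second derivatives ([smooth_derive_commute]). Applied to the torus action as a joint function of
    time and position, it makes the fields K_j commute ([Kfield_lie_bracket]) and have holomorphic
    components ([Kfield_cauchy_riemann]). A constant antisymmetric combination of commuting
    holomorphic fields is a holomorphic Poisson bivector ([schouten_bracket_commuting],
    [sigma_of_poisson]). Finally [contract_dbar_closed] reduces dbar-closedness of the contraction
    to d omega = 0. *)

Section DirectionalDerivatives.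
Variable R : realType.

(** A directional derivative sees only the values on a line, so functions on different spaces that
    agree along corresponding lines have the same one. Time derivatives, partial derivatives and
    derivatives of slices are identified in this way throughout. *)
Lemma growth_line (V W U : normedModType R) (f : V -> U) (g : W -> U) a v y w :
  (forall h : R, g (h *: w + y) = f (h *: v + a)) ->
  (fun h : R => h^-1 *: ((g \o shift y) (h *: w) - g y)) =
  (fun h => h^-1 *: ((f \o shift a) (h *: v) - f a)).
Proof.
move=> gf; apply/funext => h /=; rewrite gf.
by have := gf 0; rewrite !scale0r !add0r => ->.
Qed.

Lemma derive_line (V W U : normedModType R) (f : V -> U) (g : W -> U) a v y w :
  (forall h : R, g (h *: w + y) = f (h *: v + a)) -> 'D_w g y = 'D_v f a.
Proof. by move=> /growth_line gf; rewrite /derive gf. Qed.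

Lemma derivable_line (V W U : normedModType R) (f : V -> U) (g : W -> U) a v y w :
  (forall h : R, g (h *: w + y) = f (h *: v + a)) ->
  derivable f a v -> derivable g y w.
Proof. by move=> /growth_line gf; rewrite /derivable gf. Qed.

Lemma derive_along (V U : normedModType R) (f : V -> U) a v s :
  'D_1 (fun h : R => f (h *: v + a)) s = 'D_v f (s *: v + a).
Proof.
by apply: derive_line => h; rewrite [h *: 1]mulr1 scalerDl addrA.
Qed.

Lemma derivable_along (V U : normedModType R) (f : V -> U) a v s :
  derivable f (s *: v + a) v -> derivable (fun h : R => f (h *: v + a)) s 1.
Proof.
by apply: derivable_line => h; rewrite [h *: 1]mulr1 scalerDl addrA.
Qed.

(** Both signs of [s] are covered because the coordinate increments in [C1_differentiable] have
    arbitrary sign. *)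
Lemma MVT_along (V : normedModType R) (f : V -> R) (y v : V) (s : R) :
  (forall r, `|r| <= `|s| -> derivable f (r *: v + y) v) ->
  exists2 r, `|r| <= `|s| & f (s *: v + y) - f y = s * 'D_v f (r *: v + y).
Proof.
move=> dfv; pose phi (h : R) := f (h *: v + y).
have dphi r : `|r| <= `|s| -> is_derive (r : R) (1 : R) phi ('D_v f (r *: v + y)).
  move=> rs; apply: DeriveDef; last exact: derive_along.
  exact/derivable_along/dfv.
have mvt (a b : R) : a <= b -> {in `[a, b], forall r, `|r| <= `|s|} ->
    exists2 r, `|r| <= `|s| & phi b - phi a = 'D_v f (r *: v + y) * (b - a).
  move=> ab abs; case: (@MVT_segment R phi (fun r => 'D_v f (r *: v + y)) a b ab).
  - by move=> r /subset_itv_oo_cc rab; apply/dphi/abs.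
  - by apply: derivable_within_continuous => r rab; case: (dphi r (abs r rab)).
  - by move=> c /abs cs E; exists c.
have phi0 : phi 0 = f y by rewrite /phi scale0r add0r.
have [s0|s0] := leP 0 s.
- case: (mvt 0 s s0) => [r|r rs].
    by rewrite in_itv /= => /andP[r0 rs]; rewrite !ger0_norm.
  by rewrite phi0 subr0 mulrC; exists r.
- case: (mvt s 0 (ltW s0)) => [r|r rs].
    rewrite in_itv /= => /andP[sr r0].
    by rewrite ler0_norm // ltr0_norm // lerN2.
  move=> E; exists r => //; rewrite -phi0 -opprB E; ring.
Qed.

(** The vertices of the staircase path from 0 to [h] that moves along one axis at a time. *)
Definition trunc_row n (k : nat) (h : 'rV[R]_n) : 'rV[R]_n :=
  \row_j (if (j < k)%N then h 0 j else 0).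

Lemma trunc_rowS n (k : 'I_n) (h : 'rV[R]_n) :
  trunc_row k.+1 h = h 0 k *: ebase R k + trunc_row k h.
Proof.
apply/rowP => j; rewrite !mxE ltnS leq_eqVlt eqxx /=.
have [jk|jk] := eqVneq j k; first by rewrite jk ltnn mulr1 addr0 eqxx.
by rewrite val_eqE (negPf jk) mulr0 add0r.
Qed.

Lemma norm_rowP n (h : 'rV[R]_n) (r : R) : 0 <= r ->
  (forall j, `|h 0 j| <= r) -> `|h| <= r.
Proof.
move=> r0 hr; rewrite [`|h|]/Num.Def.normr /= mx_normrE (bigmax_le _ r0) //.
by case=> i j _ /=; rewrite ord1.
Qed.

Lemma norm_coord n (h : 'rV[R]_n) j : `|h 0 j| <= `|h|.
Proof.
rewrite [X in _ <= X]/Num.Def.normr /= mx_normrE.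
exact: (le_bigmax _ (fun ij : 'I_1 * 'I_n => `|h ij.1 ij.2|) (0, j)).
Qed.

Lemma row_dot_linear n (g : 'I_n -> R) :
  linear (fun h : 'rV[R]_n => \sum_b h 0 b * g b).
Proof.
move=> a u v; rewrite scaler_sumr -big_split /=; apply: eq_bigr => b _.
by rewrite !mxE mulrDl -mulrA.
Qed.

(** The increment of [f] telescopes along the staircase of [trunc_row]. By the mean value theorem
    each step is a coordinate of [h] times a partial derivative at a nearby point, which by
    continuity is close to the one at [x]. *)
Lemma C1_differentiable n (f : 'rV[R]_n -> R) (U : set 'rV[R]_n) x :
  open U -> U x ->
  (forall b y, U y -> derivable f y (ebase R b)) ->
  (forall b, {for x, continuous ('D_(ebase R b) f)}) ->
  differentiable f x.
Proof.
move=> oU Ux df cf.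
pose linM := GRing.isLinear.Build _ _ _ _ _
  (row_dot_linear (fun b => 'D_(ebase R b) f x)).
pose L : {linear 'rV[R]_n -> R} := HB.pack (fun h : 'rV[R]_n =>
  \sum_b h 0 b * 'D_(ebase R b) f x) linM.
have cL : continuous L.
  move=> h; rewrite /continuous_at /= /L /=.
  apply: cvg_big => [||b _]; [exact: add_continuous|exact: nbhs_filter|].
  by apply: cvgMr_tmp; [exact: nbhs_filter|exact: (@coord_continuous R 1 n 0 b h)].
suff dL : f \o shift x = cst (f x) + (L : 'rV[R]_n -> R) +o_ (0 : 'rV[R]_n) (@idfun 'rV[R]_n).
  by apply/diff_locallyP; rewrite (diff_unique cL dL).
apply/eqaddoP => e e0.
(* Each of the [n] steps costs at most [d] times the norm of [h]; the successor keeps the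
   denominator nonzero when [n = 0]. *)
pose d := e / n.+1%:R.
have [s s0 hs] : exists2 s : R, 0 < s & forall y, `|y - x| < s ->
    U y /\ forall b, `|'D_(ebase R b) f y - 'D_(ebase R b) f x| <= d.
  have : \forall y \near x, U y /\ forall b, `|'D_(ebase R b) f y - 'D_(ebase R b) f x| <= d.
    near=> y; split; first by near: y; exact: open_nbhs_nbhs.
    move=> b; move: b; near: y; apply: filter_forall => b.
    have /cvgrPdist_le := cf b; move=> /(_ d); rewrite divr_gt0 // => /(_ isT).
    by apply: filterS => y; rewrite distrC.
  move=> /nbhs_ballP[s s0 hs]; exists s => // y ys.
  by apply: hs; rewrite -ball_normE /= distrC.
near=> h.
have hh : `|h| < s.
  by near: h; apply/nbhs_ballP; exists s => // h; rewrite -ball_normE /= sub0r normrN.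
rewrite !fctE /=.
have -> : f (h + x) - (f x + L h) = \sum_(b < n)
   (f (trunc_row b.+1 h + x) - f (trunc_row b h + x) - h 0 b * 'D_(ebase R b) f x).
  rewrite sumrB opprD addrA; congr (_ - _).
  rewrite -(big_mkord xpredT (fun b => f (trunc_row b.+1 h + x) - f (trunc_row b h + x))).
  rewrite telescope_sumr //; congr (f _ - f _).
    by congr (_ + _); apply/rowP => j; rewrite !mxE ltn_ord.
  by rewrite -[LHS]add0r; congr (_ + _); apply/rowP => j; rewrite !mxE.
have step (b : 'I_n) : `|f (trunc_row b.+1 h + x) - f (trunc_row b h + x) -
     h 0 b * 'D_(ebase R b) f x| <= d * `|h|.
  have trunc_le t : `|t| <= `|h 0 b| -> `|t *: ebase R b + trunc_row b h| <= `|h|.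
    move=> tb; apply: norm_rowP => // j; rewrite !mxE eqxx /=.
    case: eqP => [->|_]; last by rewrite mulr0 add0r; case: ifP => _; rewrite ?normr0 ?norm_coord.
    by rewrite ltnn mulr1 addr0 (le_trans tb) ?norm_coord.
  have near_x t : `|t| <= `|h 0 b| -> `|t *: ebase R b + (trunc_row b h + x) - x| < s.
    by move=> /trunc_le tb; rewrite addrA addrK (le_lt_trans tb).
  have := @MVT_along _ f (trunc_row b h + x) (ebase R b) (h 0 b).
  case=> [t /near_x /hs[Ut _]|t tb]; first exact: df.
  rewrite addrA -trunc_rowS => ->; rewrite -mulrBr normrM mulrC.
  by apply: ler_pM => //; [have [_ ->] := hs _ (near_x _ tb)|exact: norm_coord].
apply: le_trans (ler_norm_sum _ _ _) _.
apply: le_trans (ler_sum _ (fun b _ => step b)) _.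
rewrite sumr_const card_ord -mulr_natr mulrAC ler_wpM2r //.
by rewrite /d mulrAC ler_pdivrMr // ler_wpM2l ?ler_nat ?ltW.
Unshelve. all: by end_near. Qed.
End DirectionalDerivatives.

Section MixedDerivatives.
Variable R : realType.

Lemma derive_sum_ebase n (f : 'rV[R]_n -> R) x v : differentiable f x ->
  'D_v f x = \sum_b v 0 b * 'D_(ebase R b) f x.
Proof.
move=> df; rewrite deriveE // {1}(row_sum_delta v) linear_sum.
by apply: eq_bigr => b _; rewrite linearZ /= -deriveE.
Qed.

Lemma derive_curve n (f : 'rV[R]_n -> R) (g : R -> 'rV[R]_n) s :
  (forall a, derivable (fun h => g h 0 a) s 1) -> differentiable f (g s) ->
  'D_1 (f \o g) s = \sum_a 'D_1 (fun h => g h 0 a) s * 'D_(ebase R a) f (g s).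
Proof.
move=> dg df.
have Dg : derivable g s 1 by apply/derivable_mxP => i j; rewrite ord1; apply: dg.
have dfg : differentiable g s by exact/derivable1_diffP.
rewrite deriveE; last exact: differentiable_comp.
rewrite diff_comp //= -!deriveE // derive_sum_ebase //.
by apply: eq_bigr => a _; rewrite derive_mx // mxE.
Qed.

(* The second difference of [f] over a small parallelogram; it is symmetric   *)
(* in [v] and [w], whence [derive_commute].                                   *)
Lemma derive_derive_cross (V : normedModType R) (f : V -> R) (U : set V) x v w (d : R) :
  nbhs x U -> (forall y, U y -> derivable f y v) ->
  (forall y, U y -> derivable ('D_v f) y w) ->
  {for x, continuous ('D_w ('D_v f))} -> 0 < d ->
  exists2 s : R, 0 < s & forall h, 0 < h -> h < s ->
    `|f (h *: w + (h *: v + x)) - f (h *: w + x) - f (h *: v + x) + f x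
     - h ^+ 2 * 'D_w ('D_v f) x| <= h ^+ 2 * d.
Proof.
move=> Ux dv dwv cwv d0.
have [s s0 hs] : exists2 s : R, 0 < s & forall y, `|y - x| < s ->
    U y /\ `|'D_w ('D_v f) y - 'D_w ('D_v f) x| <= d.
  have : \forall y \near x, U y /\ `|'D_w ('D_v f) y - 'D_w ('D_v f) x| <= d.
    near=> y; split; first by near: y.
    by near: y; have /cvgrPdistC_le := cwv; apply.
  move=> /nbhs_ballP[s s0 hs]; exists s => // y ys.
  by apply: hs; rewrite -ball_normE /= distrC.
have vw0 : 0 < `|v| + `|w| + 1 by rewrite ltr_wpDl // addr_ge0.
(* This bound on [h] keeps the whole parallelogram in the ball of radius [s] about [x]; the [+ 1]
   keeps the denominator positive when both vectors vanish. *)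
exists (s / (`|v| + `|w| + 1)); first exact: divr_gt0.
move=> h h0; rewrite ltr_pdivlMr // => hsmall.
have nh : `|h| = h by rewrite gtr0_norm.
have small a b : `|a| <= h -> `|b| <= h -> `|a *: w + (b *: v + x) - x| < s.
  move=> ah bh; rewrite addrA addrK (le_lt_trans (ler_normD _ _)) //.
  rewrite !normrZ; apply: le_lt_trans hsmall.
  by rewrite mulrDr mulr1 mulrDr addrC ler_wpDr ?(ltW h0) // lerD // ler_wpM2r.
have z0 : `|0 : R| <= h by rewrite normr0 ltW.
(* The second difference is the increment of [g] along [v]. A mean value along [v], then one along
   [w], turn it into [h ^+ 2] times the mixed derivative at a point of the parallelogram. *)
pose g y := f (h *: w + y) - f y.
have dfh r : `|r| <= h -> derivable (fun y => f (h *: w + y)) (r *: v + x) v.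
  move=> rh; apply: (@derivable_line R V V R f _ (h *: w + (r *: v + x)) v).
    by move=> t; rewrite addrCA.
  by apply/dv; case: (hs (h *: w + (r *: v + x))) => //; apply: small; rewrite ?nh.
have df r : `|r| <= h -> derivable f (r *: v + x) v.
  move=> rh; apply/dv; case: (hs (r *: v + x)) => //.
  by have := small 0 r z0 rh; rewrite scale0r add0r.
have dg r : `|r| <= `|h| -> derivable g (r *: v + x) v.
  by rewrite nh => rh; apply: derivableB; [apply: dfh|apply: df].
have [r rh gE] := MVT_along dg.
rewrite nh in rh.
have Dg : 'D_v g (r *: v + x) =
    'D_v f (h *: w + (r *: v + x)) - 'D_v f (r *: v + x).
  rewrite deriveB; [|exact: dfh|exact: df]; congr (_ - _).
  by apply: derive_line => t; rewrite addrCA.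
have [q|q qh DE] := @MVT_along R V ('D_v f) (r *: v + x) w h.
  rewrite nh => qh; apply: dwv.
  by case: (hs (q *: w + (r *: v + x))) => //; apply: small.
rewrite nh in qh.
have -> : f (h *: w + (h *: v + x)) - f (h *: w + x) - f (h *: v + x) + f x =
    g (h *: v + x) - g x by rewrite /g; ring.
rewrite gE Dg DE.
have [_ le_d] := hs _ (small q r qh rh).
rewrite mulrA -expr2 -mulrBr normrM ger0_norm ?sqr_ge0 //.
by rewrite ler_wpM2l ?sqr_ge0.
Unshelve. all: by end_near. Qed.

Lemma derive_commute (V : normedModType R) (f : V -> R) (U : set V) x v w :
  nbhs x U -> (forall y, U y -> derivable f y v) ->
  (forall y, U y -> derivable f y w) ->
  (forall y, U y -> derivable ('D_v f) y w) ->
  (forall y, U y -> derivable ('D_w f) y v) ->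
  {for x, continuous ('D_w ('D_v f))} ->
  {for x, continuous ('D_v ('D_w f))} ->
  'D_w ('D_v f) x = 'D_v ('D_w f) x.
Proof.
move=> Ux dv dw dwv dvw cwv cvw; apply/eqP; rewrite -subr_eq0 -normr_le0.
apply/ler_addgt0Pr => d d0; rewrite add0r.
have d20 : 0 < d / 2 by rewrite divr_gt0.
have [s s0 hs] := derive_derive_cross Ux dv dwv cwv d20.
have [t t0 ht] := derive_derive_cross Ux dw dvw cvw d20.
pose h := Num.min s t / 2.
have m0 : 0 < Num.min s t by rewrite lt_min s0 t0.
have h0 : 0 < h by rewrite divr_gt0.
have hm : h < Num.min s t by rewrite /h ltr_pdivrMr // ltr_pMr // ltr1n.
have [hms hmt] : h < s /\ h < t by move: hm; rewrite lt_min => /andP.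
have := hs h h0 hms.
have := ht h h0 hmt.
rewrite (addrCA (h *: v)).
set a := f _; set b := f _; set c := f _; set A := 'D_v _ _; set B := 'D_w _ _.
move=> hA hB.
rewrite -(ler_pM2l (exprn_gt0 2 h0)) -{1}(ger0_norm (sqr_ge0 h)) -normrM.
have -> : h ^+ 2 * (B - A) = (a - b - c + f x - h ^+ 2 * A) - (a - c - b + f x - h ^+ 2 * B).
  by ring.
apply: le_trans (ler_normB _ _) _.
by apply: le_trans (lerD hA hB) _; rewrite -mulrDr -splitr.
Qed.
End MixedDerivatives.

(** * Smooth functions *)

Section CkTheory.
Variables (R : realType) (n : nat).
Implicit Types (U : set 'rV[R]_n) (f g : 'rV[R]_n -> R).

Lemma CkW k U f : Ck k.+1 U f -> Ck k U f.
Proof.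
elim: k f => [|k IH] f [cf /= Df]; first by split.
by split => // b; case: (Df b) => df /IH.
Qed.

Lemma near_eq_open (T : topologicalType) (V : Type) (U : set T) (f g : T -> V) x :
  open U -> U x -> (forall y, U y -> f y = g y) -> \forall y \near x, f y = g y.
Proof. by move=> oU Ux fg; apply: filterS fg _; exact: open_nbhs_nbhs. Qed.

Lemma near_eq_continuous (T V : topologicalType) (f g : T -> V) x :
  (\forall y \near x, f y = g y) -> {for x, continuous f} -> {for x, continuous g}.
Proof.
move=> fg cf; rewrite /prop_for /continuous_at -(nbhs_singleton fg).
exact: (cvg_trans (near_eq_cvg fg) cf).
Qed.

Lemma Ck_ext k U f g : open U -> (forall x, U x -> f x = g x) -> Ck k U f -> Ck k U g.
Proof.
move=> oU; elim: k f g => [|k IH] f g fg [cf Df]; have nfg x (Ux : U x) := near_eq_open oU Ux fg.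
  by split => // x Ux; exact: near_eq_continuous (nfg x Ux) (cf x Ux).
split=> [x Ux|b]; first exact: near_eq_continuous (nfg x Ux) (cf x Ux).
have [df Cf] := Df b; split=> [x Ux|].
  by apply: near_eq_derivable (df x Ux); exact: nfg.
apply: IH Cf => x Ux; apply: near_eq_derive; exact: nfg.
Qed.

Lemma Ck_cst k U a : Ck k U (cst a).
Proof.
elim: k a => [|k IH] a; split => //.
  by move=> x _; apply: cst_continuous.
  by move=> x _; apply: cst_continuous.
move=> b; split => [x _|]; first exact: derivable_cst.
rewrite (_ : (fun x => _) = cst 0) //; apply/funext => x; exact: derive_cst.
Qed.

Lemma CkD k U f g : open U -> Ck k U f -> Ck k U g -> Ck k U (f + g).
Proof.
move=> oU; elim: k f g => [|k IH] f g [cf Df] [cg Dg].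
  by split => // x Ux; exact: continuousD (cf x Ux) (cg x Ux).
split=> [x Ux|b]; first by exact: continuousD (cf x Ux) (cg x Ux).
have [df /= Cf] := Df b; have [dg /= Cg] := Dg b.
split=> [x Ux|]; first by apply: derivableD; [exact: df|exact: dg].
apply: (Ck_ext oU _ (IH _ _ Cf Cg)) => x Ux /=.
by rewrite deriveD; [|exact: df|exact: dg].
Qed.

Lemma CkM k U f g : open U -> Ck k U f -> Ck k U g -> Ck k U (f * g).
Proof.
move=> oU; elim: k f g => [|k IH] f g kf kg; have [cf Df] := kf; have [cg Dg] := kg.
  by split => // x Ux; exact: continuousM (cf x Ux) (cg x Ux).
split=> [x Ux|b]; first by exact: continuousM (cf x Ux) (cg x Ux).
have [df /= Cf] := Df b; have [dg /= Cg] := Dg b.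
split=> [x Ux|]; first by apply: derivableM; [exact: df|exact: dg].
have H := CkD oU (IH _ _ (CkW kf) Cg) (IH _ _ (CkW kg) Cf).
apply: (Ck_ext oU _ H) => x Ux /=.
by rewrite deriveM; [|exact: df|exact: dg].
Qed.
End CkTheory.

Section SmoothTheory.
Variable R : realType.

Section FixedDimension.
Variable n : nat.
Implicit Types (U V : set 'rV[R]_n) (f g : 'rV[R]_n -> R) (x : 'rV[R]_n).

Lemma smooth_ext U f g : (forall x, U x -> f x = g x) -> smooth_on U f -> smooth_on U g.
Proof. by move=> fg [oU Cf]; split=> // k; apply: Ck_ext (Cf k). Qed.

Lemma smooth_cst U (a : R) : open U -> smooth_on U (fun=> a).
Proof. by move=> oU; split=> // k; apply: Ck_cst. Qed.

Lemma smoothD U f g : smooth_on U f -> smooth_on U g -> smooth_on U (fun x => f x + g x).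
Proof. by move=> [oU Cf] [_ Cg]; split=> // k; apply: CkD. Qed.

Lemma smoothM U f g : smooth_on U f -> smooth_on U g -> smooth_on U (fun x => f x * g x).
Proof. by move=> [oU Cf] [_ Cg]; split=> // k; apply: CkM. Qed.

Lemma smooth_sum U (I : Type) (r : seq I) (F : I -> 'rV[R]_n -> R) : open U ->
  (forall i, smooth_on U (F i)) -> smooth_on U (fun x => \sum_(i <- r) F i x).
Proof.
move=> oU CF; elim: r => [|i r IH].
  by apply: (smooth_ext _ (smooth_cst 0 oU)) => x _; rewrite big_nil.
by apply: (smooth_ext _ (smoothD (CF i) IH)) => x _; rewrite big_cons.
Qed.

Lemma smooth_continuous U f x : smooth_on U f -> U x -> {for x, continuous f}.
Proof. by move=> [_ Cf] Ux; case: (Cf 0%N) => cf _; exact: cf. Qed.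

Lemma smooth_ebase U f b : smooth_on U f -> smooth_on U ('D_(ebase R b) f).
Proof. by move=> [oU Cf]; split=> // k; case: (Cf k.+1) => _ /(_ b)[]. Qed.

(** [smooth_on] speaks only of partial derivatives along the axes. Total differentiability gives
    arbitrary directions ([smooth_derive]) and the chain rule along curves. *)
Lemma smooth_differentiable U f x : smooth_on U f -> U x -> differentiable f x.
Proof.
move=> Sf Ux; have [oU Cf] := Sf; apply: (C1_differentiable oU Ux) => b.
  by have [_ /(_ b)[df _]] := Cf 1%N.
exact: smooth_continuous (smooth_ebase b Sf) Ux.
Qed.

Lemma smooth_derivable U f x v : smooth_on U f -> U x -> derivable f x v.
Proof. by move=> Sf Ux; apply/diff_derivable/(smooth_differentiable Sf Ux). Qed.

Lemma smooth_derive U f v : smooth_on U f -> smooth_on U ('D_v f).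
Proof.
move=> Sf; have [oU _] := Sf.
apply: (@smooth_ext U (fun x => \sum_(b < n) v 0 b * 'D_(ebase R b) f x)).
  by move=> x Ux; rewrite derive_sum_ebase //; apply: smooth_differentiable Sf Ux.
by apply: smooth_sum => // b; apply: smoothM (smooth_cst _ oU) (smooth_ebase b Sf).
Qed.

Lemma smooth_derive_commute U f x v w : smooth_on U f -> U x ->
  'D_w ('D_v f) x = 'D_v ('D_w f) x.
Proof.
move=> Sf Ux; have [oU _] := Sf.
have nU : nbhs x U by exact: open_nbhs_nbhs.
apply: (derive_commute nU).
- by move=> y; apply: smooth_derivable Sf.
- by move=> y; apply: smooth_derivable Sf.
- by move=> y; apply: smooth_derivable (smooth_derive v Sf).
- by move=> y; apply: smooth_derivable (smooth_derive w Sf).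
- exact: smooth_continuous (smooth_derive w (smooth_derive v Sf)) Ux.
- exact: smooth_continuous (smooth_derive v (smooth_derive w Sf)) Ux.
Qed.

End FixedDimension.

Section Slice.
Variables (n1 n2 : nat) (s : 'rV[R]_n1).

Lemma row_mx_continuous : continuous (fun x : 'rV[R]_n2 => row_mx s x).
Proof.
move=> x A /nbhs_ballP[e /= e0 eA]; apply/nbhs_ballP; exists e => //= y [_ xy].
apply: eA; split=> // i j; rewrite !mxE.
by case: splitP => k _; [exact: ballxx|exact: xy].
Qed.

Lemma slice_line (h : R) (b : 'I_n2) (x : 'rV[R]_n2) :
  row_mx s (h *: ebase R b + x) = h *: ebase R (rshift n1 b) + row_mx s x.
Proof.
have -> : ebase R (rshift n1 b) = row_mx 0 (ebase R b).
  by rewrite /ebase delta_mx_rshift.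
by rewrite scale_row_mx add_row_mx scaler0 add0r.
Qed.

Lemma derive_slice (f : 'rV[R]_(n1 + n2) -> R) b x :
  'D_(ebase R b) (fun x => f (row_mx s x)) x = 'D_(ebase R (rshift n1 b)) f (row_mx s x).
Proof. by apply: derive_line => h; rewrite slice_line. Qed.

(** Used to freeze the time variable at 0, both in the torus action ([Kfield_smooth]) and in the
    family J_t ([tderiv_smooth]). *)
Lemma smooth_slice (U : set 'rV[R]_(n1 + n2)) (V : set 'rV[R]_n2) f :
  open V -> (forall x, V x -> U (row_mx s x)) -> smooth_on U f ->
  smooth_on V (fun x => f (row_mx s x)).
Proof.
move=> oV VU [oU Cf]; split=> // k; elim: k f {Cf}(Cf k) => [|k IH] f [cf Df].
  split=> // x /VU Ux.
  by apply: continuous_comp; [exact: row_mx_continuous|exact: cf].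
split=> [x /VU Ux|b].
  by apply: continuous_comp; [exact: row_mx_continuous|exact: cf].
have [df Cf] := Df (rshift n1 b); split=> [x /VU /df|].
  by apply: derivable_line => h; rewrite slice_line.
by apply: Ck_ext (IH _ Cf) => // x _; rewrite derive_slice.
Qed.

End Slice.
End SmoothTheory.

(** * Wirtinger calculus *)

Section ComplexCalculus.
Variables (R : realType) (m : nat).
Local Notation C := (R[i]).
Implicit Types (U V : set 'rV[R]_(m + m)) (f g : 'rV[R]_(m + m) -> C).
Implicit Types (x v : 'rV[R]_(m + m)) (a s z : C).

Lemma complexP (y z : C) :
  complex.Re y = complex.Re z -> complex.Im y = complex.Im z -> y = z.
Proof. by case: y z => [? ?] [? ?] /= -> ->. Qed.

(** The minus sign is written [(-1) *] so that [smoothD], [smoothM] and [derive_mulDmul] apply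
    directly. *)
Lemma ReM (y z : C) :
  complex.Re (y * z) = complex.Re y * complex.Re z + (-1) * (complex.Im y * complex.Im z).
Proof. by case: y z => [? ?] [? ?] /=; rewrite mulN1r. Qed.

Lemma ImM (y z : C) :
  complex.Im (y * z) = complex.Re y * complex.Im z + complex.Im y * complex.Re z.
Proof. by case: y z => [? ?] [? ?] /=. Qed.

Lemma ReD (y z : C) : complex.Re (y + z) = complex.Re y + complex.Re z.
Proof. exact: raddfD. Qed.

Lemma ImD (y z : C) : complex.Im (y + z) = complex.Im y + complex.Im z.
Proof. exact: raddfD. Qed.

Lemma smoothC_ext U f g : (forall x, U x -> f x = g x) ->
  smoothC_on U f -> smoothC_on U g.
Proof.
by move=> fg [Rf If]; split;
  [apply: smooth_ext Rf => x Ux|apply: smooth_ext If => x Ux]; rewrite fg.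
Qed.

Lemma smoothC_open U f : smoothC_on U f -> open U.
Proof. by case=> -[]. Qed.

Lemma smoothC_cst U a : open U -> smoothC_on U (fun=> a).
Proof. by move=> oU; split; apply: smooth_cst. Qed.

Lemma smoothCD U f g : smoothC_on U f -> smoothC_on U g ->
  smoothC_on U (fun x => f x + g x).
Proof.
move=> [Rf If] [Rg Ig]; split.
  by apply: smooth_ext (smoothD Rf Rg) => x _; rewrite ReD.
by apply: smooth_ext (smoothD If Ig) => x _; rewrite ImD.
Qed.

Lemma smoothCM U f g : smoothC_on U f -> smoothC_on U g ->
  smoothC_on U (fun x => f x * g x).
Proof.
move=> Sf; have oU := smoothC_open Sf; case: Sf => [Rf If] [Rg Ig]; split.
  apply: smooth_ext (smoothD (smoothM Rf Rg)
    (smoothM (smooth_cst (-1) oU) (smoothM If Ig))) => x _.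
  by rewrite ReM.
apply: smooth_ext (smoothD (smoothM Rf Ig) (smoothM If Rg)) => x _.
by rewrite ImM.
Qed.

Lemma smoothC_sum U (I : Type) (r : seq I) (F : I -> 'rV[R]_(m + m) -> C) : open U ->
  (forall i, smoothC_on U (F i)) -> smoothC_on U (fun x => \sum_(i <- r) F i x).
Proof.
move=> oU CF; elim: r => [|i r IH].
  by apply: (smoothC_ext _ (smoothC_cst 0 oU)) => x _; rewrite big_nil.
by apply: (smoothC_ext _ (smoothCD (CF i) IH)) => x _; rewrite big_cons.
Qed.

Lemma smoothC_real U (f : 'rV[R]_(m + m) -> R) : smooth_on U f ->
  smoothC_on U (fun x => (f x)%:C%C).
Proof. by move=> Sf; split=> //=; apply: smooth_cst; case: Sf. Qed.

Lemma dirC_ext U v f g x : open U -> U x -> (forall y, U y -> f y = g y) ->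
  dirC v f x = dirC v g x.
Proof.
move=> oU Ux fg; apply: complexP => /=; apply: near_eq_derive;
  by apply: (near_eq_open oU Ux) => y /fg ->.
Qed.

Lemma dirC_cst v a x : dirC v (fun=> a) x = 0.
Proof. by apply: complexP => /=; apply: derive_cst. Qed.

Lemma dirCD U v f g x : smoothC_on U f -> smoothC_on U g -> U x ->
  dirC v (fun y => f y + g y) x = dirC v f x + dirC v g x.
Proof.
move=> [Rf If] [Rg Ig] Ux; apply: complexP => /=.
  rewrite -deriveD; [|exact: smooth_derivable Rf Ux|exact: smooth_derivable Rg Ux].
  by congr ('D_v _ x); apply/funext => y; rewrite ReD.
rewrite -deriveD; [|exact: smooth_derivable If Ux|exact: smooth_derivable Ig Ux].
by congr ('D_v _ x); apply/funext => y; rewrite ImD.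
Qed.

(** One Leibniz computation for both parts of a complex product: [c = -1] for the real part, [c = 1]
    for the imaginary part. *)
Lemma derive_mulDmul (p q r s : 'rV[R]_(m + m) -> R) (c : R) x v :
  derivable p x v -> derivable q x v -> derivable r x v -> derivable s x v ->
  'D_v (fun y => p y * q y + c * (r y * s y)) x =
  ('D_v p x * q x + c * ('D_v r x * s x)) + (p x * 'D_v q x + c * (r x * 'D_v s x)).
Proof.
move=> dp dq dr ds.
have dpq : derivable (p * q) x v by exact: (derivableM dp dq).
have drs : derivable (r * s) x v by exact: (derivableM dr ds).
have dcrs : derivable (c *: (r * s)) x v by exact: (derivableZ drs).
rewrite (deriveD dpq dcrs) (deriveZ _ drs) (deriveM dp dq) (deriveM dr ds).
rewrite /GRing.scale /=.
move: ('D_v p x) ('D_v q x) ('D_v r x) ('D_v s x) (p x) (q x) (r x) (s x).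
clear; move=> *; ring.
Qed.

Lemma dirCM U v f g x : smoothC_on U f -> smoothC_on U g -> U x ->
  dirC v (fun y => f y * g y) x = dirC v f x * g x + f x * dirC v g x.
Proof.
move=> [Rf If] [Rg Ig] Ux.
have dRf : derivable (fun y => complex.Re (f y)) x v := smooth_derivable Rf Ux.
have dIf : derivable (fun y => complex.Im (f y)) x v := smooth_derivable If Ux.
have dRg : derivable (fun y => complex.Re (g y)) x v := smooth_derivable Rg Ux.
have dIg : derivable (fun y => complex.Im (g y)) x v := smooth_derivable Ig Ux.
apply: complexP; rewrite ?ReD ?ImD !(ReM, ImM) /=.
  rewrite -(derive_mulDmul (-1) dRf dRg dIf dIg).
  by congr ('D_v _ x); apply/funext => y; rewrite ReM.
transitivity ('D_v (fun y => complex.Re (f y) * complex.Im (g y) +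
    1 * (complex.Im (f y) * complex.Re (g y))) x).
  by congr ('D_v _ x); apply/funext => y; rewrite ImM mul1r.
by rewrite (derive_mulDmul 1 dRf dIg dIf dRg) !mul1r.
Qed.

(* [wirt] and [wirtb] are the cases [s = - 'i] and [s = 'i]. *)
Definition wirt_of s (j : 'I_m) f x : C :=
  2^-1 * (dirC (ebase R (lshift m j)) f x + s * dirC (ebase R (rshift m j)) f x).

Lemma wirtE j f x : wirt j f x = wirt_of (- 'i%C) j f x.
Proof. by rewrite /wirt /wirt_of mulNr. Qed.

Lemma wirtbE j f x : wirtb j f x = wirt_of 'i%C j f x.
Proof. by []. Qed.

Lemma wirt_of_ext U s j f g x : open U -> U x -> (forall y, U y -> f y = g y) ->
  wirt_of s j f x = wirt_of s j g x.
Proof. by move=> oU Ux fg; rewrite /wirt_of !(dirC_ext _ oU Ux fg). Qed.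

Lemma wirt_of_cst s j a x : wirt_of s j (fun=> a) x = 0.
Proof. by rewrite /wirt_of !dirC_cst mulr0 addr0 mulr0. Qed.

Lemma wirt_ofD U s j f g x : smoothC_on U f -> smoothC_on U g -> U x ->
  wirt_of s j (fun y => f y + g y) x = wirt_of s j f x + wirt_of s j g x.
Proof.
move=> Sf Sg Ux; rewrite /wirt_of !(dirCD _ Sf Sg Ux) -mulrDr; congr (_ * _).
by rewrite mulrDr addrACA.
Qed.

Fact wirt_of_leibniz (A : comRingType) (h a b c d s f g : A) :
  h * (a * g + f * b + s * (c * g + f * d)) =
  h * (a + s * c) * g + f * (h * (b + s * d)).
Proof. ring. Qed.

Lemma wirt_ofM U s j f g x : smoothC_on U f -> smoothC_on U g -> U x ->
  wirt_of s j (fun y => f y * g y) x = wirt_of s j f x * g x + f x * wirt_of s j g x.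
Proof.
move=> Sf Sg Ux; rewrite /wirt_of !(dirCM _ Sf Sg Ux).
exact: wirt_of_leibniz.
Qed.

Lemma wirt_of_sum U s j (I : Type) (r : seq I) (F : I -> 'rV[R]_(m + m) -> C) x :
  open U -> (forall i, smoothC_on U (F i)) -> U x ->
  wirt_of s j (fun y => \sum_(i <- r) F i y) x = \sum_(i <- r) wirt_of s j (F i) x.
Proof.
move=> oU SF Ux; elim: r => [|i r IH].
  rewrite big_nil -[RHS](wirt_of_cst s j 0 x); apply: (wirt_of_ext s j oU Ux) => y _.
  by rewrite big_nil.
rewrite big_cons -IH -(wirt_ofD s j (SF i) (smoothC_sum r oU SF) Ux).
by apply: (wirt_of_ext s j oU Ux) => y _; rewrite big_cons.
Qed.

Lemma wirt_of_linear U s j a f x : smoothC_on U f -> U x ->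
  wirt_of s j (fun y => a * f y) x = a * wirt_of s j f x.
Proof.
move=> Sf Ux; rewrite (wirt_ofM _ _ (smoothC_cst a (smoothC_open Sf)) Sf Ux).
by rewrite wirt_of_cst mul0r add0r.
Qed.

End ComplexCalculus.

(** * Linear algebra of the standard complex structure *)

Section SchoutenAlgebra.
Variables (A : comRingType) (m : nat) (c : 'I_m -> 'I_m -> A).
Variables (K : 'I_m -> 'I_m -> A) (P : 'I_m -> 'I_m -> 'I_m -> A).
Hypothesis c_antisym : forall a b, c a b = - c b a.
Hypothesis K_commute : forall a b k,
  \sum_l K a l * P l b k = \sum_l K b l * P l a k.
Let s i l := \sum_a \sum_b c a b * (K a i * K b l).
Let d l j k := \sum_a \sum_b c a b * (P l a j * K b k + K a j * P l b k).

(* Here [P l a j] stands for the derivative of [K a j] along [ddz l] and      *)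
(* [d l] for that of [s]. The bracket is the cyclic sum of                    *)
(* [B i j k - B i k j], where [B] is symmetric in its first two indices.      *)
Lemma schouten_bracket_commuting i j k :
  \sum_l (s i l * d l j k + s j l * d l k i + s k l * d l i j) = 0.
Proof.
pose M i b := \sum_a c a b * K a i.
pose B i j k := \sum_b \sum_a M i b * M j a * \sum_l K b l * P l a k.
have sE i' l : s i' l = \sum_b M i' b * K b l.
  rewrite /s exchange_big; apply: eq_bigr => b _; rewrite mulr_suml.
  by apply: eq_bigr => a _; rewrite mulrA.
(* Antisymmetry of [c] turns the terms that differentiate the first factor into minus the others
   with [j'] and [k'] exchanged. *)
have dE l j' k' : d l j' k' = \sum_a (M j' a * P l a k' - M k' a * P l a j').
  rewrite /d sumrB addrC -sumrN.
  under eq_bigr do under eq_bigr do rewrite mulrDr.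
  under eq_bigr do rewrite big_split.
  rewrite big_split /=; congr (_ + _).
    apply: eq_bigr => a _; rewrite -mulNr -sumrN mulr_suml.
    by apply: eq_bigr => b _; rewrite [c a b]c_antisym !mulNr mulrA mulrAC.
  rewrite exchange_big; apply: eq_bigr => b _; rewrite mulr_suml.
  by apply: eq_bigr => a _; rewrite mulrA.
have BE i' j' k' : \sum_l s i' l * d l j' k' = B i' j' k' - B i' k' j'.
  rewrite /B -sumrB; under eq_bigr do rewrite sE mulr_suml.
  rewrite exchange_big; apply: eq_bigr => b _.
  rewrite -sumrB; under eq_bigr do rewrite dE mulr_sumr.
  rewrite exchange_big; apply: eq_bigr => a _.
  rewrite [M i' b * M j' a * _]mulr_sumr [M i' b * M k' a * _]mulr_sumr -sumrB.
  apply: eq_bigr => l _.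
  ring.
have Bsym i' j' k' : B i' j' k' = B j' i' k'.
  rewrite /B exchange_big; apply: eq_bigr => b _; apply: eq_bigr => a _.
  by rewrite K_commute [M i' _ * _]mulrC.
rewrite !big_split /= !BE (Bsym j k i) (Bsym k i j) (Bsym j i k); ring.
Qed.

End SchoutenAlgebra.

Section StandardComplexStructure.
Variables (R : realType) (m : nat).
Local Notation C := (R[i]).
Local Notation std := (@std_cplx R m).

(* Rows of [Zmx] are the [dz k], columns of [Wh] and [Wb] the [ddz j] and     *)
(* the [ddzb j].                                                              *)
Definition Zmx : 'M[C]_(m, m + m) := row_mx 1%:M ('i%C)%:M.
Definition Wh : 'M[C]_(m + m, m) := 2^-1 *: col_mx 1%:M (- 'i%C)%:M.
Definition Wb : 'M[C]_(m + m, m) := 2^-1 *: col_mx 1%:M ('i%C)%:M.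

Lemma sqrC_i : ('i%C : C) * 'i%C = -1.
Proof. by rewrite -expr2 sqr_i. Qed.

Lemma dzE k (v : 'cV[C]_(m + m)) : dz k v = (Zmx *m v) k 0.
Proof.
rewrite /dz /Zmx -[v in RHS]vsubmxK mul_row_col mul1mx mul_scalar_mx.
by rewrite !mxE.
Qed.

Lemma ddzE j : @ddz R m j = col j Wh.
Proof.
apply/colP => x; rewrite /ddz /Wh !mxE.
case: splitP => y xy; rewrite !mxE; congr (_ * _).
  have -> : x = lshift m y by apply: val_inj.
  by rewrite eq_lshift eq_lrshift !andbT mulr0 subr0.
have -> : x = rshift m y by apply: val_inj.
by rewrite eq_rshift eq_rlshift !andbT sub0r mulr_natr mulNrn.
Qed.

Lemma ddzbE j : @ddzb R m j = col j Wb.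
Proof.
apply/colP => x; rewrite /ddzb /Wb !mxE.
case: splitP => y xy; rewrite !mxE; congr (_ * _).
  have -> : x = lshift m y by apply: val_inj.
  by rewrite eq_lshift eq_lrshift !andbT mulr0 addr0.
have -> : x = rshift m y by apply: val_inj.
by rewrite eq_rshift eq_rlshift !andbT add0r mulr_natr.
Qed.

Lemma toCM k l n (A : 'M[R]_(k, l)) (B : 'M[R]_(l, n)) : toC (A *m B) = toC A *m toC B.
Proof. exact: map_mxM. Qed.

Lemma Zmx_std : Zmx *m toC std = 'i%C *: Zmx.
Proof.
rewrite /Zmx /std_cplx /toC map_block_mx mul_row_block !(map_mx0, map_mxN, map_mx1).
rewrite !(mulmx0, mul0mx, mulmx1, mul1mx, mulmxN) add0r addr0 scale_row_mx.
by rewrite scalemx1 scale_scalar_mx sqrC_i raddfN.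
Qed.

(** A real matrix commuting with [std] has blocks A, -B, B, A; [Hmx] is the complex matrix A + iB of
    the same linear map. *)
Definition Hmx (D : 'M[R]_(m + m)) : 'M[C]_m :=
  toC (ulsubmx D) + 'i%C *: toC (dlsubmx D).

Lemma std_commute_block (D : 'M[R]_(m + m)) : D *m std = std *m D ->
  D = block_mx (ulsubmx D) (- dlsubmx D) (dlsubmx D) (ulsubmx D).
Proof.
rewrite -{1 2}[D]submxK /std_cplx !mulmx_block.
rewrite !(mulmx0, mul0mx, mulmx1, mul1mx, mulmxN, mulNmx) !(add0r, addr0).
by move=> /eq_block_mx[urE _ drE _]; rewrite -[LHS]submxK urE drE.
Qed.

Lemma std_commuteE (D : 'M[R]_(m + m)) k l : D *m std = std *m D ->
  D (rshift m k) (rshift m l) = D (lshift m k) (lshift m l) /\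
  D (lshift m k) (rshift m l) = - D (rshift m k) (lshift m l).
Proof.
move=> /std_commute_block /matrixP DD; split; rewrite DD.
  by rewrite block_mxEdr !mxE.
by rewrite block_mxEur !mxE.
Qed.

Section Commute.
Variables (D : 'M[R]_(m + m)) (stdD : D *m std = std *m D).
Let A := ulsubmx D.
Let B := dlsubmx D.
Let DE : toC D = block_mx (toC A) (- toC B) (toC B) (toC A).
Proof. by rewrite {1}(std_commute_block stdD) /toC map_block_mx map_mxN. Qed.

(** A complex linear map preserves types: it acts through [Hmx D] on the dz and the d/dz, and
    through the conjugate matrix on the d/dzbar. All transformation rules between holomorphic charts
    come from this lemma and the next two. *)
Lemma Zmx_commute : Zmx *m toC D = Hmx D *m Zmx.
Proof.
rewrite DE /Zmx mul_row_block mul_mx_row; congr row_mx.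
  by rewrite mul1mx mulmx1 mul_scalar_mx.
rewrite mul1mx mul_scalar_mx mul_mx_scalar /Hmx scalerDr scalerA sqrC_i scaleN1r.
by rewrite addrC.
Qed.

Lemma Wh_commute : toC D *m Wh = Wh *m Hmx D.
Proof.
rewrite DE /Wh -scalemxAr -scalemxAl mul_block_col mul_col_mx; congr (_ *: col_mx _ _).
  by rewrite mulmx1 mul1mx mul_mx_scalar scalerN scaleNr opprK.
rewrite mulmx1 mul_scalar_mx mul_mx_scalar /Hmx scalerDr scalerA mulNr sqrC_i opprK scale1r.
by rewrite addrC.
Qed.

Lemma Wb_commute : toC D *m Wb = Wb *m map_mx conjc (Hmx D).
Proof.
have -> : map_mx conjc (Hmx D) = toC A - 'i%C *: toC B.
  apply/matrixP => k l; rewrite !mxE rmorphD rmorphM /=; congr (_ + _).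
    by rewrite /= oppr0.
  by apply: complexP => /=; ring.
rewrite DE /Wb -scalemxAr -scalemxAl mul_block_col mul_col_mx; congr (_ *: col_mx _ _).
  by rewrite mulmx1 mul1mx mul_mx_scalar scalerN.
rewrite mulmx1 mul_scalar_mx mul_mx_scalar scalerBr scalerA sqrC_i scaleN1r opprK.
by rewrite addrC.
Qed.

End Commute.
End StandardComplexStructure.

(** * Torus action *)

Section ChartTheory.
Variables (R : realType) (n : nat) (M : smoothManifold R n).
Implicit Types (c : chart R M n) (p : M).

Lemma cod_open c : atlas c -> open (cod c).
Proof. by case/atlas_chart. Qed.

Lemma ptK c p : atlas c -> dom c p -> pt c (coord c p) = p.
Proof. by case/atlas_chart => _ _ H _ _ /H. Qed.

Lemma cod_coord c p : dom c p -> cod c (coord c p).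
Proof. by exists p. Qed.

Lemma coordK c x : atlas c -> cod c x -> coord c (pt c x) = x.
Proof. by move=> ac [p dp <-]; rewrite ptK. Qed.

Lemma dom_pt c x : atlas c -> cod c x -> dom c (pt c x).
Proof. by move=> ac [p dp <-]; rewrite ptK. Qed.

Lemma transition_differentiable c c' p a : atlas c -> atlas c' -> dom c p -> dom c' p ->
  differentiable (fun x => coord c' (pt c x) 0 a) (coord c p).
Proof.
move=> ac ac' dp dp'; apply: (smooth_differentiable (atlas_smooth ac ac' a)).
by exists p.
Qed.

End ChartTheory.

Section TorusFlow.
Variables (R : realType) (m : nat) (X : toricManifold R m) (xi : 'M[R]_m).
Implicit Types (c : chart R X (m + m)) (p : X) (s : 'rV[R]_m).
Local Notation K := (Kfield xi).
Local Notation V j := (row_mx (row j xi) (0 : 'rV[R]_(m + m))).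

(** Time and position form a single variable, as in [act_smooth], so that time and space derivatives
    are directional derivatives of one smooth function and commute. *)
Definition flow c c' a (y : 'rV[R]_(m + (m + m))) : R :=
  coord c' (act (lsubmx y) (pt c (rsubmx y))) 0 a.

Definition flow_dom c c' : set 'rV[R]_(m + (m + m)) :=
  [set y | cod c (rsubmx y) /\ dom c' (act (lsubmx y) (pt c (rsubmx y)))].

Lemma flow_row_mx c c' a s x : flow c c' a (row_mx s x) = coord c' (act s (pt c x)) 0 a.
Proof. by rewrite /flow row_mxKl row_mxKr. Qed.

Lemma smooth_flow c c' a : atlas c -> atlas c' -> smooth_on (flow_dom c c') (flow c c' a).
Proof. by move=> ac ac'; apply: act_smooth. Qed.

Lemma flow_domP c c' s p : atlas c -> dom c p -> dom c' (act s p) ->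
  flow_dom c c' (row_mx s (coord c p)).
Proof.
move=> ac dp dsp; rewrite /flow_dom /= row_mxKl row_mxKr ptK //; split=> //.
exact: cod_coord.
Qed.

Lemma flow_dom0 c p : atlas c -> dom c p -> flow_dom c c (row_mx 0 (coord c p)).
Proof. by move=> ac dp; apply: flow_domP; rewrite ?act0. Qed.

Lemma flow_dom0_cod c x : atlas c -> cod c x -> flow_dom c c (row_mx 0 x).
Proof. by move=> ac [p dp <-]; apply: flow_dom0. Qed.

Lemma V_line (h : R) j s x : h *: V j + row_mx s x = row_mx (h *: row j xi + s) x.
Proof. by rewrite scale_row_mx add_row_mx scaler0 add0r. Qed.

(** By the group law, the time derivative of the action at any time [s], not only at 0, is the
    generating field at the point reached. *)
Lemma Kfield_act j c p s a : atlas c -> dom c p ->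
  K j c (act s p) a 0 = 'D_(V j) (flow c c a) (row_mx s (coord c p)).
Proof.
move=> ac dp; rewrite mxE derive1E; apply: derive_line => h.
by rewrite V_line flow_row_mx ptK // actD [h *: 1]mulr1 addr0.
Qed.

Lemma Kfield_flow j c p a : atlas c -> dom c p ->
  K j c p a 0 = 'D_(V j) (flow c c a) (row_mx 0 (coord c p)).
Proof. by move=> ac dp; rewrite -{1}[p]act0; apply: Kfield_act. Qed.

Lemma Kfield_smooth j c a : atlas c -> smooth_on (cod c) (fun x => K j c (pt c x) a 0).
Proof.
move=> ac; have Sf := smooth_derive (V j) (smooth_flow a ac ac).
apply: smooth_ext (smooth_slice (cod_open ac) _ Sf).
  by move=> x cx; rewrite Kfield_flow ?coordK //; apply: dom_pt.
by move=> x; apply: flow_dom0_cod.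
Qed.

(* The index [a] is not idle: [act_smooth] yields the openness of [flow_dom]  *)
(* only through a coordinate, of which there is none when [m = 0].            *)
Lemma near_flow_dom c p s (a : 'I_(m + m)) : atlas c -> dom c p ->
  \forall h \near (0 : R), flow_dom c c (row_mx (h *: s) (coord c p)).
Proof.
move=> ac dp; have [oU _] := smooth_flow a ac ac.
pose V := row_mx s (0 : 'rV[R]_(m + m)).
have VE h : row_mx (h *: s) (coord c p) = h *: V + row_mx 0 (coord c p).
  by rewrite scale_row_mx add_row_mx scaler0 add0r addr0.
have cV : continuous_at (0 : R) (fun h : R => h *: V + row_mx 0 (coord c p)).
  exact: (continuousD (@scalel_continuous _ _ V 0) (@cst_continuous _ _ _ _)).
have := cV (flow_dom c c); rewrite scale0r add0r => /(_ _).
have nU : nbhs (row_mx 0 (coord c p)) (flow_dom c c).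
  exact: (open_nbhs_nbhs (conj oU (flow_dom0 ac dp))).
move=> /(_ nU) nV.
have nV' : \forall h \near (0 : R), flow_dom c c (h *: V + row_mx 0 (coord c p)) by [].
by apply: filterS nV' => h; rewrite -VE.
Qed.

Lemma near_act_dom c p s (a : 'I_(m + m)) : atlas c -> dom c p ->
  \forall h \near (0 : R), dom c (act (h *: s) p).
Proof.
move=> ac dp; apply: filterS (near_flow_dom s a ac dp) => h [_].
by rewrite row_mxKl row_mxKr ptK.
Qed.

Lemma derivable_orbit j c p a : atlas c -> dom c p ->
  derivable (fun h : R => coord c (act (h *: row j xi) p) 0 a) 0 1.
Proof.
move=> ac dp.
have df : derivable (flow c c a) (row_mx 0 (coord c p)) (V j).
  exact: (smooth_derivable (smooth_flow a ac ac) (flow_dom0 ac dp)).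
apply: derivable_line df => h.
by rewrite V_line flow_row_mx ptK // [h *: 1]mulr1 !addr0.
Qed.

Lemma derive_along_orbit j c p (f : 'rV[R]_(m + m) -> R) : atlas c -> dom c p ->
  differentiable f (coord c p) ->
  'D_1 (fun h : R => f (coord c (act (h *: row j xi) p))) 0 =
  \sum_a K j c p a 0 * 'D_(ebase R a) f (coord c p).
Proof.
move=> ac dp df.
have g0 : coord c (act ((0 : R) *: row j xi) p) = coord c p by rewrite scale0r act0.
rewrite -g0 in df *.
rewrite (@derive_curve _ _ f (fun h => coord c (act (h *: row j xi) p))) //.
  by apply: eq_bigr => a _; rewrite mxE derive1E.
by move=> a; apply: derivable_orbit.
Qed.

Lemma Kfield_transform j c c' p : atlas c -> atlas c' -> dom c p -> dom c' p ->
  K j c' p = dmap id c c' p *m K j c p.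
Proof.
move=> ac ac' dp dp'; apply/colP => a; rewrite !mxE derive1E.
have := derive_along_orbit j ac dp (transition_differentiable a ac ac' dp dp').
under [in X in _ = X -> _]eq_bigr do rewrite mulrC.
move=> E; under [RHS]eq_bigr do rewrite mxE.
rewrite -{}E; apply: near_eq_derive.
by apply: filterS (near_act_dom (row j xi) a ac dp) => h dh; rewrite ptK.
Qed.

(** This says [K_i, K_j] = 0. Differentiating K_j along an orbit of K_i gives the second derivative
    of the flow in the time directions [V i] and [V j], which is symmetric. *)
Lemma Kfield_lie_bracket i j c p k : atlas c -> dom c p ->
  \sum_a K i c p a 0 * 'D_(ebase R a) (fun x => K j c (pt c x) k 0) (coord c p) =
  \sum_a K j c p a 0 * 'D_(ebase R a) (fun x => K i c (pt c x) k 0) (coord c p).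
Proof.
move=> ac dp.
have E i' j' : \sum_a K i' c p a 0 * 'D_(ebase R a) (fun x => K j' c (pt c x) k 0) (coord c p) =
    'D_(V i') ('D_(V j') (flow c c k)) (row_mx 0 (coord c p)).
  rewrite -derive_along_orbit //; last first.
    exact: (smooth_differentiable (Kfield_smooth _ _ ac) (cod_coord dp)).
  transitivity ('D_1 (fun h : R => 'D_(V j') (flow c c k) (row_mx (h *: row i' xi) (coord c p))) 0).
    apply: near_eq_derive.
    apply: filterS (near_act_dom (row i' xi) k ac dp) => h dh.
    by rewrite ptK // Kfield_act.
  by apply: derive_line => h; rewrite V_line [h *: 1]mulr1 !addr0.
have C := smooth_derive_commute (V j) (V i) (smooth_flow k ac ac) (flow_dom0 ac dp).
by rewrite -E -E in C.
Qed.

Section Holomorphic.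
Variables (J : tensor X) (c : chart R X (m + m)) (hc : holo_chart J c).
Hypothesis J_inv : forall s, preserves_endo (act s) J.
Let ac : atlas c := proj1 hc.

(** Each [act s] preserves [J], which is standard in the chart, so its Jacobian commutes with
    [std_cplx]. *)
Lemma flow_cauchy_riemann y k l : flow_dom c c y ->
  let D a b := 'D_(ebase R (rshift m b)) (flow c c a) y in
  D (rshift m k) (rshift m l) = D (lshift m k) (lshift m l) /\
  D (lshift m k) (rshift m l) = - D (rshift m k) (lshift m l).
Proof.
move=> [cy dy] D; pose p := pt c (rsubmx y).
have dp : dom c p by exact: dom_pt.
have DE a b : dmap (act (lsubmx y)) c c p a b = D a b.
  rewrite mxE coordK // /D; rewrite -[in RHS](hsubmxK y) -derive_slice.
  by apply: derive_line => h; rewrite flow_row_mx.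
have := J_inv ac ac dp dy; case: hc => _ stdJ; rewrite !stdJ // => /esym.
by move=> /(std_commuteE k l); rewrite !DE.
Qed.

(** K_j is a time derivative of the flow. Exchanging it with space derivatives transfers the
    Cauchy-Riemann equations from the flow to K_j. *)
Lemma Kfield_cauchy_riemann j x k l : cod c x ->
  let D a b := 'D_(ebase R b) (fun y => K j c (pt c y) a 0) x in
  D (rshift m k) (rshift m l) = D (lshift m k) (lshift m l) /\
  D (lshift m k) (rshift m l) = - D (rshift m k) (lshift m l).
Proof.
move=> cx D; pose y := row_mx (0 : 'rV[R]_m) x.
have Uy : flow_dom c c y by exact: flow_dom0_cod.
have DE a b : D a b = 'D_(V j) ('D_(ebase R (rshift m b)) (flow c c a)) y.
  rewrite (smooth_derive_commute _ _ (smooth_flow a ac ac) Uy) -derive_slice.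
  apply: near_eq_derive; apply: (near_eq_open (cod_open ac) cx) => z cz.
  by rewrite Kfield_flow ?coordK //; apply: dom_pt.
have oU (a : 'I_(m + m)) : open (flow_dom c c) by case: (smooth_flow a ac ac).
have CR := flow_cauchy_riemann k l.
rewrite !DE; split.
  apply: near_eq_derive; apply: (near_eq_open (oU (lshift m k)) Uy) => z /CR[]//.
rewrite -deriveN; last first.
  exact: (smooth_derivable (smooth_derive _ (smooth_flow _ ac ac)) Uy).
apply: near_eq_derive; apply: (near_eq_open (oU (lshift m k)) Uy) => z /CR[]//.
Qed.

End Holomorphic.

End TorusFlow.

(** * The holomorphic Poisson structure *)

Section ComplexNumbers.
Variable R : realType.
Implicit Types a b : R.

Lemma half_add (z : R[i]) : 2^-1 * (z + z) = z.
Proof. by rewrite -mulr2n -[z *+ 2]mulr_natl mulrA mulVf ?mul1r ?pnatr_eq0. Qed.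

(** If f has u-derivative a + ib, the Cauchy-Riemann equations make its t-derivative -b + ia; then
    d/dz f is the u-derivative and, by the next lemma, d/dzbar f vanishes. *)
Lemma wirt_cauchy_riemann a b : 2^-1 * (Complex a b - 'i%C * Complex (- b) a) = Complex a b.
Proof.
rewrite -[RHS]half_add; congr (_ * (_ + _)).
by apply: complexP; rewrite /= ?mul0r ?mul1r; ring.
Qed.

Lemma wirtb_cauchy_riemann a b : 2^-1 * (Complex a b + 'i%C * Complex (- b) a) = 0.
Proof.
rewrite (_ : 'i%C * _ = - Complex a b) ?subrr ?mulr0 //.
by apply: complexP; rewrite /= ?mul0r ?mul1r; ring.
Qed.

End ComplexNumbers.

(** * Change of holomorphic chart for T^{1,0}-valued forms *)

Section HolomorphicCharts.
Variables (R : realType) (m : nat) (X : smoothManifold R (m + m)) (J : tensor X).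
Hypothesis J_endo : preserves_endo id J.
Variables (c c' : chart R X (m + m)) (p : X).
Hypotheses (hc : holo_chart J c) (hc' : holo_chart J c') (dp : dom c p) (dp' : dom c' p).
Let D := dmap id c c' p.

Lemma dmap_std_commute : D *m std_cplx R m = std_cplx R m *m D.
Proof.
have [ac Jc] := hc; have [ac' Jc'] := hc'.
by have := J_endo ac ac' dp dp'; rewrite Jc // Jc'.
Qed.

Lemma holo_jacE : holo_jac c c' p = Hmx D.
Proof.
apply/matrixP => k l; have [Dr Dl] := std_commuteE k l dmap_std_commute.
rewrite !mxE in Dr Dl *; rewrite /wirt /dirC /= Dr Dl wirt_cauchy_riemann.
by apply: complexP; rewrite /= ?mul0r ?mul1r; ring.
Qed.

Lemma Zmx_transform : Zmx R m *m toC D = holo_jac c c' p *m Zmx R m.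
Proof. by rewrite holo_jacE Zmx_commute // dmap_std_commute. Qed.

Lemma Wh_transform : toC D *m Wh R m = Wh R m *m holo_jac c c' p.
Proof. by rewrite holo_jacE Wh_commute // dmap_std_commute. Qed.

Lemma Wb_transform : toC D *m Wb R m = Wb R m *m map_mx conjc (holo_jac c c' p).
Proof. by rewrite holo_jacE Wb_commute // dmap_std_commute. Qed.

Lemma form11E (w : tensor X) c0 q : form11 w c0 q = (Wh R m)^T *m toC (w c0 q) *m Wb R m.
Proof.
apply/matrixP => k l; rewrite mxE ddzE ddzbE !colE trmx_mul trmx_delta !mulmxA.
by rewrite -colE mxE -!mulmxA -rowE mxE.
Qed.

Lemma contractE (s : ctensor X) (w : tensor X) c0 q :
  contract s w c0 q = (form11 w c0 q)^T *m s c0 q.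
Proof.
apply/matrixP => j k; rewrite mxE [RHS]mxE; apply: eq_bigr => l _.
by rewrite [X in _ = X * _]mxE.
Qed.

(** The part of [T] mapping T^{0,1} to T^{1,0}; the transpose puts the index of dzbar^j first, as in
    [form01]. *)
Definition ks_of (T : tensor X) : ctensor X := fun c p =>
  (Zmx R m *m toC (T c p) *m Wb R m)^T.

Lemma ks_formE (F : R -> tensor X) c0 q : ks_form F c0 q = ks_of (tderiv F) c0 q.
Proof.
by apply/matrixP => j k; rewrite mxE [RHS]mxE ddzbE dzE colE !mulmxA -colE mxE.
Qed.

Lemma ks_of_transform (T : tensor X) : T c' p *m D = D *m T c p ->
  (map_mx conjc (holo_jac c c' p))^T *m ks_of T c' p = ks_of T c p *m (holo_jac c c' p)^T.
Proof.
move=> TD; rewrite -!trmx_mul; congr _^T.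
rewrite -!mulmxA -Wb_transform [toC (T c' p) *m _]mulmxA -toCM TD toCM.
by rewrite [RHS]mulmxA -Zmx_transform -!mulmxA.
Qed.

Lemma contract_transform (s : ctensor X) (w : tensor X) :
  w c p = D^T *m w c' p *m D ->
  s c' p = holo_jac c c' p *m s c p *m (holo_jac c c' p)^T ->
  (map_mx conjc (holo_jac c c' p))^T *m contract s w c' p =
  contract s w c p *m (holo_jac c c' p)^T.
Proof.
move=> wD sH.
have hT : (Wh R m)^T *m toC D^T = (holo_jac c c' p)^T *m (Wh R m)^T.
  by rewrite -trmx_mul -Wh_transform trmx_mul /toC map_trmx.
have fE : form11 w c p =
    (holo_jac c c' p)^T *m form11 w c' p *m map_mx conjc (holo_jac c c' p).
  by rewrite !form11E wD !toCM -!mulmxA Wb_transform !mulmxA hT.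
by rewrite !contractE sH fE !trmx_mul trmxK !mulmxA.
Qed.

End HolomorphicCharts.

(** * Holomorphic torus fields and the bivector sigma *)

Section InfinitesimalHolomorphy.
Variables (R : realType) (m : nat) (X : toricManifold R m) (xi : 'M[R]_m) (J : tensor X).
Implicit Types (c : chart R X (m + m)) (p : X) (x : 'rV[R]_(m + m)).
Hypothesis J_inv : forall s, preserves_endo (act s) J.
Hypothesis J_endo : preserves_endo id J.
Local Notation K := (Kfield xi).

(* The component along [ddz k] of [K_j], as a function of the coordinates. *)
Definition Kholo c j k x : R[i] :=
  Complex (K j c (pt c x) (lshift m k) 0) (K j c (pt c x) (rshift m k) 0).

Lemma Kholo_smooth c j k : atlas c -> smoothC_on (cod c) (Kholo c j k).
Proof. by move=> ac; split; apply: Kfield_smooth. Qed.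

Lemma dz_Kfield c j k x : dz k (toC (K j c (pt c x))) = Kholo c j k x.
Proof.
by rewrite /dz /Kholo ![toC _ _ _]mxE; apply: complexP; rewrite /= ?mul0r ?mul1r; ring.
Qed.

(** The forms dz^k satisfy dz^k J = i dz^k, hence kill the (0,1) part of K_j. *)
Lemma dz_K10 c p j k : holo_chart J c -> dom c p ->
  dz k (K10 xi J j c p) = dz k (toC (K j c p)).
Proof.
move=> [ac Jc] dp; rewrite !dzE /K10 Jc // toCM -scalemxAr mulmxBr -scalemxAr.
rewrite mulmxA Zmx_std -scalemxAl scalerA sqrC_i scaleN1r opprK.
by rewrite mxE [X in _ * X]mxE half_add.
Qed.

Variables (C : 'M[R]_m).
Let s := sigma_of xi J C.

Lemma sigma_ofE c x k l : holo_chart J c -> cod c x ->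
  s c (pt c x) k l =
  \sum_a \sum_b (2 * (C a b)%:C%C) * (Kholo c a k x * Kholo c b l x).
Proof.
move=> hc cx; rewrite mxE mulr_sumr; apply: eq_bigr => a _; rewrite mulr_sumr.
have dx : dom c (pt c x) by apply: dom_pt => //; case: hc.
by apply: eq_bigr => b _; rewrite !dz_K10 // !dz_Kfield !mulrA.
Qed.

Lemma sigma_of_smooth c k l : holo_chart J c ->
  smoothC_on (cod c) (fun x => s c (pt c x) k l).
Proof.
move=> hc; have ac := proj1 hc; have oc := cod_open ac.
apply: (smoothC_ext (fun x cx => esym (sigma_ofE k l hc cx))).
apply: smoothC_sum => // a; apply: smoothC_sum => // b.
by apply: smoothCM; [exact: smoothC_cst|apply: smoothCM; exact: Kholo_smooth].
Qed.

Lemma wirt_of_sigma r c x j k l : holo_chart J c -> cod c x ->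
  wirt_of r j (fun y => s c (pt c y) k l) x =
  \sum_a \sum_b (2 * (C a b)%:C%C) *
    (wirt_of r j (Kholo c a k) x * Kholo c b l x +
     Kholo c a k x * wirt_of r j (Kholo c b l) x).
Proof.
move=> hc cx; have ac := proj1 hc; have oc := cod_open ac.
have Sk a b : smoothC_on (cod c) (fun y => Kholo c a k y * Kholo c b l y).
  by apply: smoothCM; exact: Kholo_smooth.
have Sc a b : smoothC_on (cod c) (fun y => (2 * (C a b)%:C%C) * (Kholo c a k y * Kholo c b l y)).
  by apply: smoothCM; [exact: smoothC_cst|].
rewrite (wirt_of_ext _ _ oc cx (fun y => @sigma_ofE c y k l hc)).
rewrite (wirt_of_sum _ _ _ oc (fun a => smoothC_sum _ oc (Sc a)) cx).
apply: eq_bigr => a _; rewrite (wirt_of_sum _ _ _ oc (Sc a) cx).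
apply: eq_bigr => b _; rewrite (wirt_of_linear _ _ _ (Sk a b) cx).
by rewrite (wirt_ofM _ _ (Kholo_smooth _ _ ac) (Kholo_smooth _ _ ac) cx).
Qed.

Lemma Kholo_wirt c j k l x : holo_chart J c -> cod c x ->
  wirt l (Kholo c j k) x =
  Complex ('D_(ebase R (lshift m l)) (fun y => K j c (pt c y) (lshift m k) 0) x)
          ('D_(ebase R (lshift m l)) (fun y => K j c (pt c y) (rshift m k) 0) x).
Proof.
move=> hc cx; have [E1 E2] := Kfield_cauchy_riemann xi hc J_inv j k l cx.
by rewrite /wirt /dirC /= E1 E2 wirt_cauchy_riemann.
Qed.

Lemma Kholo_wirtb c j k l x : holo_chart J c -> cod c x ->
  wirtb l (Kholo c j k) x = 0.
Proof.
move=> hc cx; have [E1 E2] := Kfield_cauchy_riemann xi hc J_inv j k l cx.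
by rewrite /wirtb /dirC /= E1 E2 wirtb_cauchy_riemann.
Qed.

(** On a holomorphic function, the complex field K^{1,0} acts as the real field K. The identity is
    thus [Kfield_lie_bracket] for the real and imaginary components together. *)
Lemma Kholo_commute c i j k x : holo_chart J c -> cod c x ->
  \sum_l Kholo c i l x * wirt l (Kholo c j k) x =
  \sum_l Kholo c j l x * wirt l (Kholo c i k) x.
Proof.
move=> hc cx; have ac := proj1 hc.
have E i' j' : \sum_l Kholo c i' l x * wirt l (Kholo c j' k) x = Complex
    (\sum_a K i' c (pt c x) a 0 * 'D_(ebase R a) (fun y => K j' c (pt c y) (lshift m k) 0) x)
    (\sum_a K i' c (pt c x) a 0 * 'D_(ebase R a) (fun y => K j' c (pt c y) (rshift m k) 0) x).
  rewrite !big_split_ord /= -!big_split /=.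
  apply: complexP; rewrite /= raddf_sum; apply: eq_bigr => l _;
    have [E1 E2] := Kfield_cauchy_riemann xi hc J_inv j' k l cx;
    by rewrite Kholo_wirt // ?E1 ?E2 /=; ring.
have dx : dom c (pt c x) by exact: dom_pt.
have L a := Kfield_lie_bracket xi i j a ac dx.
rewrite (coordK ac cx) in L.
exact: etrans (E i j) (etrans (f_equal2 _ (L _) (L _)) (esym (E j i))).
Qed.

Lemma sigma_of_transform c c' p : holo_chart J c -> holo_chart J c' -> dom c p -> dom c' p ->
  s c' p = holo_jac c c' p *m s c p *m (holo_jac c c' p)^T.
Proof.
move=> hc hc' dp dp'.
(* The columns of [Q] are the K_a^{1,0} and sigma is 2 Q C Q^T, so only [Q] has to be
   transformed. *)
pose Q c0 : 'M[R[i]]_m := \matrix_(k, a) dz k (toC (K a c0 p)).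
have sE c0 : holo_chart J c0 -> dom c0 p -> s c0 p = 2 *: (Q c0 *m toC C *m (Q c0)^T).
  move=> h0 d0; apply/matrixP => k l; rewrite !mxE; congr (_ * _).
  rewrite exchange_big; apply: eq_bigr => b _; rewrite !mxE mulr_suml.
  by apply: eq_bigr => a _; rewrite !mxE !dz_K10 // [_%:C%C * _]mulrC.
have QE : Q c' = holo_jac c c' p *m Q c.
  apply/matrixP => k a; rewrite mxE [RHS]mxE dzE.
  rewrite (Kfield_transform xi a (proj1 hc) (proj1 hc') dp dp').
  rewrite toCM mulmxA (Zmx_transform J_endo hc hc' dp dp') -mulmxA mxE.
  by apply: eq_bigr => l _; rewrite -dzE [Q c l a]mxE.
by rewrite !sE // QE trmx_mul -scalemxAr -scalemxAl !mulmxA.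
Qed.

Lemma sigma_of_poisson : C^T = - C -> holomorphic_poisson J s.
Proof.
move=> CT.
have CA a b : 2 * (C a b)%:C%C = - (2 * (C b a)%:C%C) :> R[i].
  by have /matrixP/(_ b a) := CT; rewrite !mxE => ->; rewrite rmorphN mulrN.
split.
- by move=> c hc k l; apply: sigma_of_smooth.
- by move=> c c' p; apply: sigma_of_transform.
- move=> c p hc dp; apply/matrixP => k l; have ac := proj1 hc.
  rewrite -(ptK ac dp) mxE [RHS]mxE !sigma_ofE //; try exact: cod_coord.
  rewrite exchange_big -sumrN; apply: eq_bigr => a _.
  rewrite -sumrN; apply: eq_bigr => b _.
  by rewrite CA mulNr [Kholo c a _ _ * _]mulrC.
- move=> c p j k l hc dp; have cx := cod_coord dp.
  rewrite wirtbE wirt_of_sigma //; apply: big1 => a _; apply: big1 => b _.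
  by rewrite -!wirtbE !Kholo_wirtb // mul0r mulr0 addr0 mulr0.
move=> c p i j k hc dp; have cx := cod_coord dp; have ac := proj1 hc.
pose x := coord c p.
have sE a b : s c p a b = \sum_a' \sum_b' (2 * (C a' b')%:C%C) *
    (Kholo c a' a x * Kholo c b' b x).
  by have := sigma_ofE a b hc cx; rewrite ptK.
have dE l a b : wirt l (fun y => s c (pt c y) a b) x = \sum_a' \sum_b' (2 * (C a' b')%:C%C) *
    (wirt l (Kholo c a' a) x * Kholo c b' b x + Kholo c a' a x * wirt l (Kholo c b' b) x).
  rewrite wirtE wirt_of_sigma //; apply: eq_bigr => a' _; apply: eq_bigr => b' _.
  by rewrite !wirtE.
pose c2 a b := 2 * (C a b)%:C%C : R[i].
pose k1 a l := Kholo c a l x.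
pose k2 l a j0 := wirt l (Kholo c a j0) x.
have kc a b k' : \sum_l k1 a l * k2 l b k' = \sum_l k1 b l * k2 l a k'.
  exact: Kholo_commute.
have := @schouten_bracket_commuting _ _ c2 k1 k2 CA kc i j k.
move=> E D; apply: etrans E; apply: eq_bigr => l _.
by rewrite /D -/x !dE !sE.
Qed.

End InfinitesimalHolomorphy.

(** * Product rule for sums, invertible Jacobians and density *)

Section Sums.
Variable R : realType.

Lemma derive_sum_mul n (f g : 'I_n -> R -> R) t :
  (forall r, derivable (f r) t 1) -> (forall r, derivable (g r) t 1) ->
  'D_1 (fun h => \sum_r f r h * g r h) t =
  \sum_r ('D_1 (f r) t * g r t + f r t * 'D_1 (g r) t).
Proof.
move=> df dg.
have dfg r : derivable (f r * g r) t 1 by exact: (derivableM (df r) (dg r)).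
have -> : (fun h => \sum_r f r h * g r h) = \sum_r (f r * g r).
  by apply/funext => h; rewrite fct_sumE.
rewrite derive_sum //; apply: eq_bigr => r _.
by rewrite (deriveM (df r) (dg r)) addrC; congr (_ + _); exact: mulrC.
Qed.

Lemma derive_coord n (a b : 'I_n) (x : 'rV[R]_n) :
  'D_(ebase R b) (fun y : 'rV[R]_n => y 0 a) x = (a == b)%:R.
Proof.
transitivity ('D_1 (fun h : R => h * (a == b)%:R + x 0 a) 0).
  apply: derive_line => h.
  by rewrite !mxE eqxx /= [h *: 1]mulr1 addr0.
have di : derivable (@id R) 0 1 by exact: derivable_id.
have dc (k : R) : derivable (cst k : R -> R) 0 1 by exact: derivable_cst.
rewrite (deriveD (derivableM di (dc _)) (dc _)) (deriveM di (dc _)).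
by rewrite !derive_cst derive_id scaler0 addr0 add0r [_ *: _]mulr1.
Qed.

End Sums.

Section TransitionInverse.
Variables (R : realType) (n : nat) (M : smoothManifold R n).
Implicit Types (c : chart R M n) (p : M).

Lemma dmap_inverse c c' p : atlas c -> atlas c' -> dom c p -> dom c' p ->
  dmap id c' c p *m dmap id c c' p = 1%:M.
Proof.
move=> ac ac' dp dp'; apply/matrixP => a b; rewrite mxE [RHS]mxE.
rewrite -(derive_coord a b (coord c p)).
pose U : set 'rV[R]_n := coord c @` (dom c `&` dom c').
have oU : open U by case: (atlas_smooth ac ac' a).
have Up : U (coord c p) by exists p.
pose f x := coord c (pt c' x) 0 a.
pose g (h : R) := coord c' (pt c (h *: ebase R b + coord c p)).
have g0 : g 0 = coord c' p by rewrite /g scale0r add0r ptK.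
have df : differentiable f (g 0).
  by rewrite g0; apply: transition_differentiable.
have dg r : derivable (fun h => g h 0 r) 0 1.
  have := transition_differentiable r ac ac' dp dp'.
  move=> /(@diff_derivable _ _ _ _ _ (ebase R b)).
  by apply: derivable_line => h; rewrite [h *: 1]mulr1 addr0.
have E := derive_curve dg df.
transitivity ('D_1 (f \o g) 0).
  rewrite E; apply: eq_bigr => r _; rewrite !mxE mulrC g0; congr (_ * _).
  by apply: derive_line => h; rewrite /g [h *: 1]mulr1 addr0.
transitivity ('D_(ebase R b) (fun x => coord c (pt c' (coord c' (pt c x))) 0 a) (coord c p)).
  by apply: derive_line => h; rewrite /= /f /g [h *: 1]mulr1 addr0.
apply: near_eq_derive; apply: (near_eq_open oU Up) => y [q [dq dq'] <-].
by rewrite !ptK.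
Qed.

End TransitionInverse.

Section HoloJacInverse.
Variables (R : realType) (m : nat) (X : smoothManifold R (m + m)) (J : tensor X).
Hypothesis J_endo : preserves_endo id J.

Lemma Zmx_Wh : Zmx R m *m Wh R m = 1%:M.
Proof.
rewrite /Zmx /Wh -scalemxAr mul_row_col mul1mx -scalar_mxM mulrN sqrC_i opprK.
by apply/matrixP => k l; rewrite mxE [X in _ * X]mxE half_add.
Qed.

(** Inserting [Zmx_Wh] reduces the product of the two holomorphic Jacobians to that of the real
    ones. Invertibility lets an identity of forms be carried from one chart to another. *)
Lemma holo_jac_unit (c c' : chart R X (m + m)) p :
  holo_chart J c -> holo_chart J c' -> dom c p -> dom c' p ->
  holo_jac c c' p \in unitmx.
Proof.
move=> hc hc' dp dp'.
suff /mulmx1_unit[] : holo_jac c' c p *m holo_jac c c' p = 1%:M by [].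
rewrite -[LHS]mulmx1 -{1}Zmx_Wh !mulmxA -[_ *m Zmx R m]mulmxA.
rewrite -(Zmx_transform J_endo hc hc' dp dp') mulmxA.
rewrite -(Zmx_transform J_endo hc' hc dp' dp) -[_ *m toC _ *m toC _]mulmxA -toCM.
rewrite (dmap_inverse (proj1 hc) (proj1 hc') dp dp').
by rewrite /toC map_mx1 mulmx1 Zmx_Wh.
Qed.

End HoloJacInverse.

Section Density.
Variables (R : realType) (n : nat) (M : smoothManifold R n).

(** Where [f] and [g] differ at a point, they differ on a neighbourhood in [M], which would meet
    [D]. *)
Lemma dense_smooth_eq (c : chart R M n) (D : set M) (f g : 'rV[R]_n -> R) :
  dense D -> atlas c -> smooth_on (cod c) f -> smooth_on (cod c) g ->
  (forall p, D p -> dom c p -> f (coord c p) = g (coord c p)) ->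
  forall x, cod c x -> f x = g x.
Proof.
move=> dD ac Sf Sg fg x cx; apply/eqP; apply: contrapT => /negP neq.
have [p dp px] := cx.
have [od _ _ cc _] := atlas_chart ac.
pose O := interior [set q | dom c q /\ f (coord c q) != g (coord c q)].
have Op : O p.
  have cfg : {for p, continuous (fun q => f (coord c q) - g (coord c q))}.
    apply: (@continuous_comp _ _ _ (coord c) (fun x => f x - g x)); first exact: cc.
    by apply: continuousB; rewrite px; apply: smooth_continuous cx.
  have ne : f (coord c p) - g (coord c p) != 0 by rewrite subr_eq0 px.
  have n0 : \forall q \near p, f (coord c q) - g (coord c q) != 0.
    by apply: (cfg [set y | y != 0]); apply: open_nbhs_nbhs; split; [exact: open_neq|].
  apply: filterS2 n0 (open_nbhs_nbhs (conj od dp)) => q.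
  by rewrite subr_eq0.
have [q [Oq Dq]] := dD O (ex_intro _ p Op) (@open_interior _ _).
have [dq /eqP] := interior_subset Oq.
by apply; apply: fg.
Qed.

End Density.

Lemma dense_smoothC_eq (R : realType) (m : nat) (M : smoothManifold R (m + m))
    (c : chart R M (m + m)) (D : set M) (f g : 'rV[R]_(m + m) -> R[i]) :
  dense D -> atlas c -> smoothC_on (cod c) f -> smoothC_on (cod c) g ->
  (forall p, D p -> dom c p -> f (coord c p) = g (coord c p)) ->
  forall x, cod c x -> f x = g x.
Proof.
move=> dD ac [Rf If] [Rg Ig] fg x cx; apply: complexP.
  by apply: (dense_smooth_eq dD ac Rf Rg _ cx) => p Dp dp; rewrite fg.
by apply: (dense_smooth_eq dD ac If Ig _ cx) => p Dp dp; rewrite fg.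
Qed.

(** * Dolbeault cocycles *)

Section Cocycles.
Variables (R : realType) (m : nat) (X : smoothManifold R (m + m)).
Implicit Types (c : chart R X (m + m)) (p : X) (T w J : tensor X).

Lemma smoothC_mulmx (U : set 'rV[R]_(m + m)) k l (P : 'M[R[i]]_(k, m + m))
    (Q : 'M[R[i]]_(m + m, l)) (T : 'rV[R]_(m + m) -> 'M[R]_(m + m)) i j : open U ->
  (forall a b, smooth_on U (fun x => T x a b)) ->
  smoothC_on U (fun x => (P *m toC (T x) *m Q) i j).
Proof.
move=> oU ST.
apply: (@smoothC_ext _ _ _ (fun x => \sum_b (\sum_a P i a * (T x a b)%:C%C) * Q b j)).
  by move=> x _; rewrite mxE; apply: eq_bigr => b _; rewrite mxE; congr (_ * _);
    apply: eq_bigr => a _; rewrite mxE.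
apply: smoothC_sum => // b; apply: smoothCM; last exact: smoothC_cst.
apply: smoothC_sum => // a; apply: smoothCM; [exact: smoothC_cst|exact: smoothC_real].
Qed.

Lemma ks_of_smooth T c j k : atlas c ->
  (forall a b, smooth_on (cod c) (fun x => T c (pt c x) a b)) ->
  smoothC_on (cod c) (fun x => ks_of T c (pt c x) j k).
Proof.
move=> ac ST.
have H := @smoothC_mulmx _ _ _ (Zmx R m) (Wb R m) (fun x => T c (pt c x)) k j (cod_open ac) ST.
by apply: smoothC_ext H => x _; rewrite [RHS]mxE.
Qed.

Lemma contract_smooth (s : ctensor X) w c j k : atlas c ->
  (forall a b, smooth_on (cod c) (fun x => w c (pt c x) a b)) ->
  (forall a b, smoothC_on (cod c) (fun x => s c (pt c x) a b)) ->
  smoothC_on (cod c) (fun x => contract s w c (pt c x) j k).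
Proof.
move=> ac Sw Ss; have oc := cod_open ac.
apply: (@smoothC_ext _ _ _ (fun x => \sum_l form11 w c (pt c x) l j * s c (pt c x) l k)).
  by move=> x _; rewrite mxE.
apply: (smoothC_sum _ oc) => l; apply: smoothCM; last exact: Ss.
have H := @smoothC_mulmx _ _ _ (Wh R m)^T (Wb R m) (fun x => w c (pt c x)) l j oc Sw.
by apply: smoothC_ext H => x _; rewrite form11E.
Qed.

(** The condition J* = -J says w(JX, Y) = -w(X, JY), which makes [w] of type (1,1). *)
Lemma omega_adj_skewE w J c p : w c p \in unitmx -> omega_adj w J c p = - J c p ->
  (J c p)^T *m w c p = - (w c p *m J c p).
Proof.
move=> wu; rewrite /omega_adj => E.
by rewrite -mulmxN -E !mulmxA mulmxV // mul1mx.
Qed.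

Lemma tr_std_cplx : (std_cplx R m)^T = block_mx 0 1%:M (- 1%:M) 0.
Proof. by rewrite tr_block_mx !trmx0 trmx1 [(- 1%:M)^T]linearN /= trmx1. Qed.

(* The last hypothesis says that [w] is of type (1,1). *)
Lemma form_std_block (w : 'M[R]_(m + m)) : w^T = - w ->
  (std_cplx R m)^T *m w = - (w *m std_cplx R m) ->
  [/\ drsubmx w = ulsubmx w, dlsubmx w = - ursubmx w,
      (ulsubmx w)^T = - ulsubmx w & (ursubmx w)^T = ursubmx w].
Proof.
rewrite -[w]submxK !(block_mxKul, block_mxKur, block_mxKdl, block_mxKdr).
move: (ulsubmx w) (ursubmx w) (dlsubmx w) (drsubmx w) => A B C D.
rewrite tr_block_mx opp_block_mx => /eq_block_mx[At Ct Bt Dt].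
rewrite tr_std_cplx /std_cplx !mulmx_block.
rewrite !(mulmx0, mul0mx, mulmx1, mul1mx, mulmxN, mulNmx) !(add0r, addr0).
rewrite opp_block_mx => /eq_block_mx[CB DA _ _].
by rewrite DA CB opprK; split=> //; rewrite Bt CB opprK.
Qed.

Lemma form11_type11 w c p : (w c p)^T = - w c p ->
  (std_cplx R m)^T *m w c p = - (w c p *m std_cplx R m) ->
  form11 w c p = 2^-1 *: (toC (ulsubmx (w c p)) + 'i%C *: toC (ursubmx (w c p))).
Proof.
move=> wT wstd; have [DA CB _ _] := form_std_block wT wstd.
rewrite form11E -[in LHS](submxK (w c p)) DA CB.
set A := ulsubmx _; set B := ursubmx _.
rewrite /Wh /Wb /toC map_block_mx map_mxN -/(toC A) -/(toC B).
rewrite [(2^-1 *: _)^T]linearZ /= tr_col_mx trmx1 tr_scalar_mx -scalemxAl -scalemxAl -scalemxAr.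
rewrite mul_row_block mul_row_col !mul1mx !mul_scalar_mx mulmx1 mul_mx_scalar.
congr (_ *: _); rewrite !scaleNr scalerN opprK scalerBr scalerA sqrC_i scaleN1r opprK.
rewrite [_ + toC A]addrC.
by apply/matrixP => k l; rewrite mxE [X in _ * X]mxE half_add.
Qed.

(** As [s] is holomorphic, d/dzbar falls on the coefficients of [w] only. Their symmetry under
    exchange of [j] and [l] is the equation dbar w = 0, a part of dw = 0 for a form of type
    (1,1). *)
Lemma contract_dbar_closed (s : ctensor X) w J c p j k l :
  symplectic_form w -> holo_chart J c -> dom c p ->
  (forall q, dom c q -> omega_adj w J c q = - J c q) ->
  (forall a b, smoothC_on (cod c) (fun x => s c (pt c x) a b)) ->
  (forall r a b, wirtb r (fun x => s c (pt c x) a b) (coord c p) = 0) ->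
  wirtb l (fun x => contract s w c (pt c x) j k) (coord c p) =
  wirtb j (fun x => contract s w c (pt c x) l k) (coord c p).
Proof.
move=> [Sw _ w_nd dw] [ac Jc] dp wJ Ss s_holo.
have oc := cod_open ac; have cx := cod_coord dp; set x := coord c p in cx s_holo *.
pose W a b (y : 'rV[R]_(m + m)) : R := w c (pt c y) a b.
have SW a b : smooth_on (cod c) (W a b) by exact: Sw.
pose A a b := W (lshift m a) (lshift m b); pose B a b := W (lshift m a) (rshift m b).
pose f a b (y : 'rV[R]_(m + m)) : R[i] := Complex (A a b y) (B a b y).
have Sf a b : smoothC_on (cod c) (f a b) by split; apply: SW.
have blocks y : cod c y -> forall a b,
    [/\ W (rshift m a) (rshift m b) y = A a b y, W (rshift m a) (lshift m b) y = - B a b y,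
        A b a y = - A a b y & B b a y = B a b y].
  move=> cy a b; have dy := dom_pt ac cy.
  have [wT wu] := w_nd c _ ac dy.
  have := omega_adj_skewE wu (wJ _ dy); rewrite Jc // => wstd.
  have [/matrixP/(_ a b) E1 /matrixP/(_ a b) E2 /matrixP/(_ a b) E3 /matrixP/(_ a b) E4] :=
    form_std_block wT wstd.
  by move: E1 E2 E3 E4; rewrite !mxE.
have formE y : cod c y -> forall a b, form11 w c (pt c y) a b = 2^-1 * f a b y.
  move=> cy a b; have dy := dom_pt ac cy.
  have [wT wu] := w_nd c _ ac dy.
  have := omega_adj_skewE wu (wJ _ dy); rewrite Jc // => wstd.
  rewrite form11_type11 // !mxE; congr (_ * _).
  by apply: complexP; rewrite /= /A /B /W; ring.
have Sh a b : smoothC_on (cod c) (fun y => 2^-1 * f a b y).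
  by apply: smoothCM => //; exact: smoothC_cst.
have contr_wirtb j' l' : wirtb l' (fun y => contract s w c (pt c y) j' k) x =
    \sum_r 2^-1 * wirtb l' (f r j') x * s c (pt c x) r k.
  rewrite wirtbE (@wirt_of_ext _ _ (cod c) _ _ _
    (fun y => \sum_r (2^-1 * f r j' y) * s c (pt c y) r k)) //; last first.
    by move=> y cy; rewrite mxE; apply: eq_bigr => r _; rewrite formE.
  have Sm r : smoothC_on (cod c) (fun y => (2^-1 * f r j' y) * s c (pt c y) r k).
    exact: smoothCM (Sh _ _) (Ss _ _).
  rewrite (wirt_of_sum _ _ _ oc Sm cx); apply: eq_bigr => r _.
  rewrite (wirt_ofM _ _ (Sh _ _) (Ss _ _) cx) -!wirtbE s_holo mulr0 addr0.
  by rewrite wirtbE (wirt_of_linear _ _ _ (Sf r j') cx).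
apply: (etrans (contr_wirtb j l)); apply: (etrans _ (esym (contr_wirtb l j))).
apply: eq_bigr => r _.
suff E : wirtb l (f r j) x = wirtb j (f r l) x by rewrite E.
have nb := near_eq_open oc cx.
have dWrr v a b : 'D_v (W (rshift m a) (rshift m b)) x = 'D_v (A a b) x.
  by apply: near_eq_derive; apply: nb => y /blocks/(_ a b)[].
have dWrl v a b : 'D_v (W (rshift m a) (lshift m b)) x = - 'D_v (B a b) x.
  rewrite -deriveN; last exact: (smooth_derivable (SW _ _) cx).
  by apply: near_eq_derive; apply: nb => y /blocks/(_ a b)[].
have dA v a b : 'D_v (A b a) x = - 'D_v (A a b) x.
  rewrite -deriveN; last exact: (smooth_derivable (SW _ _) cx).
  by apply: near_eq_derive; apply: nb => y /blocks/(_ a b)[].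
have dB v a b : 'D_v (B b a) x = 'D_v (B a b) x.
  by apply: near_eq_derive; apply: nb => y /blocks/(_ a b)[].
have dW a b d : 'D_(ebase R a) (W b d) x + 'D_(ebase R b) (W d a) x + 'D_(ebase R d) (W a b) x = 0.
  exact: dw.
pose u a := ebase R (lshift m a) : 'rV[R]_(m + m).
pose t a := ebase R (rshift m a) : 'rV[R]_(m + m).
(* Instances of dw = 0 on the directions (u_l, u_j, u_r), (t_l, t_j, u_r), (t_l, t_j, t_r) and (u_l,
   u_j, t_r). The real part of the claim is [e1 - e2] and the imaginary part [e4 - e3]: the
   derivatives along u_r and t_r cancel. *)
have e1 : - 'D_(u l) (A r j) x + 'D_(u j) (A r l) x + 'D_(u r) (A l j) x = 0.
  by rewrite -(dA _ r j); exact: dW.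
have e2 : - 'D_(t l) (B r j) x + 'D_(t j) (B r l) x + 'D_(u r) (A l j) x = 0.
  by rewrite -(dB _ r j) -dWrl -(dWrr _ l j); exact: dW.
have e3 : - 'D_(t l) (A r j) x + 'D_(t j) (A r l) x + 'D_(t r) (A l j) x = 0.
  by rewrite -(dA _ r j) -(dWrr _ j r) -(dWrr _ r l) -(dWrr _ l j); exact: dW.
have e4 : 'D_(u l) (B r j) x - 'D_(u j) (B r l) x + 'D_(t r) (A l j) x = 0.
  by rewrite -(dB _ r j) -dWrl; exact: dW.
rewrite /wirtb /dirC /= -!/(u _) -!/(t _); congr (_ * _).
move: e1 e2 e3 e4.
move: ('D_(u l) (A r j) x) ('D_(u j) (A r l) x) ('D_(u r) (A l j) x).
move: ('D_(t l) (A r j) x) ('D_(t j) (A r l) x) ('D_(t r) (A l j) x).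
move: ('D_(t l) (B r j) x) ('D_(t j) (B r l) x) ('D_(u l) (B r j) x) ('D_(u j) (B r l) x).
clear=> *; apply: complexP => /=; lra.
Qed.

End Cocycles.

(** * The infinitesimal deformation *)

Section Families.
Variables (R : realType) (m : nat) (X : smoothManifold R (m + m)).
Variables (e : R) (e_gt0 : 0 < e) (J : R -> tensor X).
Hypothesis J_smooth : smooth_family e J.
Implicit Types (c : chart R X (m + m)) (p : X).

Let line1 (h : R) (x : 'rV[R]_(m + m)) :
  h *: row_mx (const_mx 1 : 'rV[R]_1) 0 + row_mx 0 x = row_mx (const_mx h) x.
Proof.
rewrite scale_row_mx add_row_mx scaler0 add0r addr0; congr row_mx.
by apply/rowP => i; rewrite !mxE mulr1.
Qed.

Let F c a b (y : 'rV[R]_(1 + (m + m))) : R := J (lsubmx y 0 0) c (pt c (rsubmx y)) a b.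
Let FE c a b h x : F c a b (row_mx (const_mx h) x) = J h c (pt c x) a b.
Proof. by rewrite /F row_mxKl row_mxKr mxE. Qed.

Let F_dom c x : cod c x ->
  [set y : 'rV[R]_(1 + (m + m)) | `|lsubmx y 0 0| < e /\ cod c (rsubmx y)] (row_mx 0 x).
Proof. by move=> cx; rewrite /= row_mxKl row_mxKr mxE normr0. Qed.

Lemma family_derivable c p a b : atlas c -> dom c p ->
  derivable (fun t => J t c p a b) 0 1.
Proof.
move=> ac dp.
have df : derivable (F c a b) (row_mx 0 (coord c p)) (row_mx (const_mx 1) 0).
  exact: (smooth_derivable (J_smooth ac a b) (F_dom (cod_coord dp))).
apply: derivable_line df => h.
by rewrite line1 FE ptK // [h *: 1]mulr1 addr0.
Qed.

Lemma tderiv_smooth c a b : atlas c -> smooth_on (cod c) (fun x => tderiv J c (pt c x) a b).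
Proof.
move=> ac; have Sf := smooth_derive (row_mx (const_mx 1) 0) (J_smooth ac a b).
have := smooth_slice (cod_open ac) (@F_dom c) Sf.
apply: smooth_ext => x cx; rewrite mxE derive1E; apply: derive_line => h.
by rewrite line1 row_mxKl row_mxKr mxE [h *: 1]mulr1 addr0.
Qed.

Lemma near0_lt_norm : \forall t \near (0 : R), `|t| < e.
Proof. by apply/nbhs_ballP; exists e => // t; rewrite -ball_normE /= sub0r normrN. Qed.

Lemma tderiv_entry c p a b (f : R -> R) : (forall t, `|t| < e -> J t c p a b = f t) ->
  tderiv J c p a b = 'D_1 f 0.
Proof.
move=> Jf; rewrite mxE derive1E; apply: near_eq_derive.
by apply: filterS near0_lt_norm => t /Jf.
Qed.

(** The Jacobian does not depend on t, so the transformation rule of J_t can be differentiated at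
    0. *)
Lemma tderiv_transform c c' p : (forall t, `|t| < e -> preserves_endo id (J t)) ->
  atlas c -> atlas c' -> dom c p -> dom c' p ->
  tderiv J c' p *m dmap id c c' p = dmap id c c' p *m tderiv J c p.
Proof.
move=> Jinv ac ac' dp dp'; set D := dmap id c c' p.
have dJ a b : derivable (fun t => J t c p a b) 0 1 by exact: family_derivable.
have dJ' a b : derivable (fun t => J t c' p a b) 0 1 by exact: family_derivable.
have dc (k : R) : derivable (fun=> k) (0 : R) (1 : R) by exact: derivable_cst.
apply/matrixP => a b; rewrite mxE [RHS]mxE.
transitivity ('D_1 (fun t => \sum_r J t c' p a r * D r b) 0).
  rewrite (@derive_sum_mul _ _ (fun r t => J t c' p a r) (fun r => fun=> D r b)) //.
  apply: eq_bigr => r _; rewrite derive_cst mulr0 addr0 -derive1E /tderiv.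
  by congr (_ * _); rewrite mxE.
transitivity ('D_1 (fun t => \sum_r D a r * J t c p r b) 0); last first.
  rewrite (@derive_sum_mul _ _ (fun r => fun=> D a r) (fun r t => J t c p r b)) //.
  apply: eq_bigr => r _; rewrite derive_cst mul0r add0r -derive1E /tderiv.
  by congr (_ * _); rewrite mxE.
apply: near_eq_derive; apply: filterS near0_lt_norm => t /Jinv/(_ c c' p ac ac' dp dp') E.
by have /matrixP/(_ a b) := E; rewrite !mxE.
Qed.

Lemma tderiv_anticommute c p : (forall t, `|t| < e -> J t c p *m J t c p = - 1%:M) ->
  atlas c -> dom c p ->
  tderiv J c p *m J 0 c p + J 0 c p *m tderiv J c p = 0.
Proof.
move=> JJ ac dp; have dJ a b : derivable (fun t => J t c p a b) 0 1 by exact: family_derivable.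
apply/matrixP => a b; rewrite mxE [X in X + _]mxE [X in _ + X]mxE [RHS]mxE -big_split /=.
transitivity ('D_1 (fun t => \sum_r J t c p a r * J t c p r b) 0).
  rewrite (@derive_sum_mul _ _ (fun r t => J t c p a r) (fun r t => J t c p r b)) //.
  by apply: eq_bigr => r _; rewrite !mxE !derive1E.
transitivity ('D_1 (cst (- (a == b)%:R) : R -> R) (0 : R)); last exact: derive_cst.
apply: near_eq_derive; apply: filterS near0_lt_norm => t /JJ /matrixP/(_ a b).
by rewrite !mxE.
Qed.

End Families.

Section BlockEntries.
Variables (V : Type) (m1 m2 n1 n2 : nat) (A : 'M[V]_(m1 + m2, n1 + n2)).

Lemma ulsubmx_entry i j : ulsubmx A i j = A (lshift m2 i) (lshift n2 j).
Proof. by rewrite !mxE. Qed.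

Lemma dlsubmx_entry i j : dlsubmx A i j = A (rshift m1 i) (lshift n2 j).
Proof. by rewrite !mxE. Qed.

Lemma drsubmx_entry i j : drsubmx A i j = A (rshift m1 i) (rshift n1 j).
Proof. by rewrite !mxE. Qed.

End BlockEntries.

(** * The computation in momentum-angle coordinates *)

Section MomentumAngle.
Variables (R : realType) (m : nat) (X : toricManifold R m) (xi : 'M[R]_m) (J : tensor X).
Variables (z c : chart R X (m + m)) (zc : momentum_angle_chart xi J z c).
Variables (p : X) (dp : dom z p).
Local Notation K := (Kfield xi).

Let hz : holo_chart J z. Proof. by case: zc => -[]. Qed.
Let az : atlas z. Proof. by case: hz. Qed.
Let ac : atlas c. Proof. by case: zc => -[]. Qed.
Let dcz : dom c = dom z. Proof. by case: zc => _ []. Qed.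
Let dcp : dom c p. Proof. by rewrite dcz. Qed.
Let D := dmap id z c p.

Lemma momentum_angle_mu q j : dom z q -> coord c q 0 (lshift m j) = muj xi j q.
Proof. by move=> dq; case: zc => _ _ _ /(_ q j dq)[]. Qed.

Lemma momentum_angle_angle q j : dom z q ->
  coord c q 0 (rshift m j) = coord z q 0 (rshift m j).
Proof. by move=> dq; case: zc => _ _ _ /(_ q j dq)[]. Qed.

Lemma momentum_angle_K j : K j z p = delta_mx (rshift m j) 0.
Proof. by case: zc => _ _ /(_ p j dp)[]. Qed.

Lemma momentum_angle_dfun j b :
  dfun (fun q => (mu q *m (row j xi)^T) 0 0) z p 0 b = D (lshift m j) b.
Proof.
rewrite !mxE; apply: near_eq_derive.
apply: (near_eq_open (cod_open az) (cod_coord dp)) => x cx /=.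
by rewrite momentum_angle_mu //; apply: dom_pt.
Qed.

(** The charts share their angles, which gives the lower blocks; [mu] is constant along orbits, so
    dmu^i(d/dt^j) = 0. *)
Lemma momentum_angle_dmap : D = block_mx (ulsubmx D) 0 0 1%:M.
Proof.
have lower i b : D (rshift m i) b = (rshift m i == b)%:R.
  rewrite -(derive_coord (rshift m i) b (coord z p)) mxE; apply: near_eq_derive.
  apply: (near_eq_open (cod_open az) (cod_coord dp)) => x cx /=.
  by rewrite momentum_angle_angle ?coordK //; apply: dom_pt.
have upper i j : D (lshift m i) (rshift m j) = 0.
  have /matrixP/(_ (lshift m i) 0) := Kfield_transform xi j az ac dp dcp.
  rewrite momentum_angle_K -colE [X in _ = X]mxE => <-.
  rewrite mxE derive1E.
  transitivity ('D_1 (cst (muj xi i p) : R -> R) (0 : R)); last exact: derive_cst.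
  apply: near_eq_derive; apply: filterS (near_act_dom (row j xi) (lshift m i) az dp) => h dh.
  by rewrite momentum_angle_mu // /muj mu_act.
rewrite -[LHS]submxK; congr block_mx; apply/matrixP => i j; rewrite !mxE.
- by rewrite -[RHS](upper i j) mxE.
- by have := lower i (lshift m j); rewrite mxE eq_rlshift.
- by have := lower i (rshift m j); rewrite mxE eq_rshift.
Qed.

Let P := ulsubmx D.

(** Hamilton's equation gives the rows of omega along K_j = d/dt^j, namely -dmu^j. Type (1,1) then
    determines the upper blocks and forces [P] to be symmetric. *)
Lemma momentum_angle_omega : omega_adj (omega X) J z p = - J z p ->
  omega X z p = block_mx 0 P (- P) 0 /\ P^T = P.
Proof.
move=> wJ; have [_ _ w_nd _] := omega_symplectic X.
have [wT wu] := w_nd z p az dp.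
have low j b : omega X z p (rshift m j) b = - D (lshift m j) b.
  have /matrixP/(_ 0 b) := mu_hamiltonian (row j xi) az dp.
  rewrite -/(K j z p) momentum_angle_K trmx_delta -rowE mxE => ->.
  by rewrite mxE momentum_angle_dfun.
have := omega_adj_skewE wu wJ; rewrite (proj2 hz) // => wstd.
have [E1 E2 _ E4] := form_std_block wT wstd.
have dl : dlsubmx (omega X z p) = - P.
  by apply/matrixP => i j; rewrite dlsubmx_entry low [RHS]mxE ulsubmx_entry.
have dr : drsubmx (omega X z p) = 0.
  apply/matrixP => i j; rewrite drsubmx_entry low momentum_angle_dmap block_mxEur.
  by rewrite [X in - X]mxE oppr0 mxE.
have ur : ursubmx (omega X z p) = P by rewrite -[LHS]opprK -E2 dl opprK.
rewrite ur in E4; split=> //.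
by rewrite -[LHS]submxK -E1 dr dl ur.
Qed.

(** K_a = d/dt^a has component i along d/dz^a, and i^2 = -1. *)
Lemma momentum_angle_sigma (C : 'M[R]_m) : sigma_of xi J C z p = - (2 *: toC C).
Proof.
apply/matrixP => k l.
have dzK a b : dz b (K10 xi J a z p) = (b == a)%:R * 'i%C.
  rewrite dz_K10 // momentum_angle_K dzE /toC map_delta_mx -colE mxE.
  by rewrite row_mxEr mxE mulr_natl.
rewrite mxE; under eq_bigr do under eq_bigr do rewrite !dzK.
rewrite (bigD1 k) //= [X in _ + X]big1 ?addr0; last first.
  move=> a /negPf ak; apply: big1 => b _.
  by rewrite [k == a]eq_sym ak !mul0r mulr0 mul0r.
rewrite (bigD1 l) //= big1 ?addr0; last first.
  by move=> b /negPf bl; rewrite [l == b]eq_sym bl mul0r mulr0.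
by rewrite !eqxx !mul1r -mulrA sqrC_i !mxE mulrN1 mulrN.
Qed.

Section Deformation.
Variables (e : R) (e_gt0 : 0 < e) (Jt : R -> tensor X) (S C : 'M[R]_m).
Hypothesis Jt0 : Jt 0 = J.
Hypothesis Jt_smooth : smooth_family e Jt.
Hypothesis Jt_endo : forall t, `|t| < e -> preserves_endo id (Jt t).
Hypothesis Jt_sqr : forall t, `|t| < e -> Jt t z p *m Jt t z p = - 1%:M.
Hypothesis Jt_form : forall t, `|t| < e ->
  Jt t c p = momentum_angle_tensor (S + t *: C).
Let T := tderiv Jt z p.

(* [J_t] in the chart [(mu, t)] determines the lower half of [T]; the upper   *)
(* right block, the derivative of [- Psi^-1], follows from [J_t ^ 2 = -1].    *)
Lemma momentum_angle_tderiv : T = block_mx 0 (C *m P) (C *m P) 0.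
Proof.
have e0 : `|0 : R| < e by rewrite normr0.
have Jblock t : `|t| < e ->
    block_mx 0 (- invmx (S + t *: C)) (S + t *: C) 0 *m block_mx P 0 0 1%:M =
    block_mx P 0 0 1%:M *m Jt t z p.
  move=> te; have := Jt_endo te az ac dp dcp; rewrite Jt_form // -/D.
  by rewrite {1 2}momentum_angle_dmap.
have blocks t : `|t| < e ->
    [/\ P *m ulsubmx (Jt t z p) = 0, dlsubmx (Jt t z p) = (S + t *: C) *m P
      & drsubmx (Jt t z p) = 0].
  move=> /Jblock; rewrite -{1}[Jt t z p]submxK !mulmx_block.
  rewrite !(mulmx0, mul0mx, mulmx1, mul1mx) !(add0r, addr0).
  by move=> /eq_block_mx[<- _ <- <-].
(* At t = 0 the structure is standard in [z], with lower left block 1. This makes [P] invertible,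
   which below kills the upper left block for every small t. *)
have SP : S *m P = 1%:M.
  have [_ + _] := blocks 0 e0; rewrite scale0r addr0 => <-.
  by rewrite Jt0 (proj2 hz) // block_mxKdl.
have [_ Pu] := mulmx1_unit SP.
have ul0 t : `|t| < e -> ulsubmx (Jt t z p) = 0.
  by move=> /blocks[E _ _]; rewrite -[LHS]mul1mx -(mulVmx Pu) -mulmxA E mulmx0.
have TE a b f : (forall t, `|t| < e -> Jt t z p a b = f t) -> T a b = 'D_1 f 0.
  exact: tderiv_entry.
have Tul : ulsubmx T = 0.
  apply/matrixP => i j; rewrite ulsubmx_entry [RHS]mxE.
  rewrite (TE _ _ (cst 0)) ?derive_cst // => t te.
  by rewrite -ulsubmx_entry ul0 // mxE.
have Tdr : drsubmx T = 0.
  apply/matrixP => i j; rewrite drsubmx_entry [RHS]mxE.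
  rewrite (TE _ _ (cst 0)) ?derive_cst // => t te.
  by have [_ _ E] := blocks t te; rewrite -drsubmx_entry E mxE.
have Tdl : dlsubmx T = C *m P.
  apply/matrixP => i j; rewrite dlsubmx_entry.
  rewrite (TE _ _ (fun t => t * (C *m P) i j + (S *m P) i j)).
    have di : derivable (@id R) 0 1 by exact: derivable_id.
    have dc (k : R) : derivable (cst k : R -> R) 0 1 by exact: derivable_cst.
    rewrite (deriveD (derivableM di (dc _)) (dc _)) (deriveM di (dc _)).
    by rewrite !derive_cst derive_id scaler0 addr0 add0r [_ *: _]mulr1.
  move=> t te; have [_ E _] := blocks t te; rewrite -dlsubmx_entry E.
  by rewrite mulmxDl -scalemxAl mxE addrC; congr (_ + _); rewrite mxE.
have := @tderiv_anticommute _ _ _ _ e_gt0 _ Jt_smooth z p Jt_sqr az dp.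
rewrite -/T Jt0 (proj2 hz) // -[T]submxK Tul Tdr Tdl /std_cplx.
rewrite !mulmx_block !(mulmx0, mul0mx, mulmx1, mul1mx, mulmxN, mulNmx) !(add0r, addr0).
rewrite add_block_mx -(block_mx0 _ m m m m) => /eq_block_mx[+ _ _ _].
by move=> /eqP; rewrite subr_eq0 => /eqP ->.
Qed.

(** The left side is (iCP)^T = i P C^T = -i P C, by symmetry of [P] and antisymmetry of [C]; the
    right side is ((i/2) P)^T (-2C). *)
Lemma momentum_angle_ks : C^T = - C -> omega_adj (omega X) J z p = - J z p ->
  ks_of (tderiv Jt) z p = contract (sigma_of xi J C) (omega X) z p.
Proof.
move=> CT wJ; have [wE PT] := momentum_angle_omega wJ.
have [_ _ w_nd _] := omega_symplectic X.
have [wT wu] := w_nd z p az dp.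
have := omega_adj_skewE wu wJ; rewrite (proj2 hz) // => wstd.
rewrite contractE form11_type11 // momentum_angle_sigma wE block_mxKul block_mxKur.
rewrite /ks_of -/T momentum_angle_tderiv.
set Q := C *m P.
have toC0 : toC (0 : 'M[R]_m) = 0 by rewrite /toC map_mx0.
rewrite /toC map_block_mx -!/(toC _) toC0 add0r.
rewrite /Zmx /Wb mul_row_block !mulmx0 add0r addr0 mul1mx mul_scalar_mx.
rewrite -scalemxAr mul_row_col mulmx1 mul_mx_scalar.
have -> : 2^-1 *: ('i%C *: toC Q + 'i%C *: toC Q) = 'i%C *: toC Q.
  by apply/matrixP => k l; rewrite mxE [X in _ * X]mxE half_add.
rewrite scalerA mulmxN -scalemxAr [((_ * _) *: _)^T]linearZ /= -scalemxAl scalerA.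
rewrite mulrA mulfV ?mul1r ?pnatr_eq0 // -scalerN.
rewrite [('i%C *: _)^T]linearZ /=; congr (_ *: _).
rewrite /Q toCM trmx_mul /toC !map_trmx CT PT -!/(toC _).
by rewrite /toC map_mxN mulmxN.
Qed.

End Deformation.
End MomentumAngle.

(** * Equality of the forms and of their classes *)

Lemma ks_form_eq_contract (R : realType) (m : nat) (X : toricManifold R m) (xi : 'M[R]_m)
    (S : X -> 'M[R]_m) (C : 'M[R]_m) (e : R) (J : R -> tensor X) :
  dense (Mring X) -> C^T = - C -> 0 < e -> KK (J 0) ->
  (forall t, `|t| < e -> DGK xi (J t)) -> smooth_family e J ->
  momentum_angle_deformation xi e J S C ->
  forall c p, holo_chart (J 0) c -> dom c p ->
  ks_form J c p = contract (sigma_of xi (J 0) C) (omega X) c p.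
Proof.
move=> dX CT e0 [[[[_ J0_endo] _] J0_inv _ _ _] J0_adj] J_DGK J_smooth J_form c p hc dp.
have J_endo t : `|t| < e -> preserves_endo id (J t) by case/J_DGK => -[[[_ +] _] _ _ _ _] _.
have J_sqr t : `|t| < e -> forall c p, atlas c -> dom c p -> J t c p *m J t c p = - 1%:M.
  by case/J_DGK => -[[_ +] _ _ _ _] _.
have ac := proj1 hc; have [Sw w_id _ _] := omega_symplectic X.
rewrite -(ptK ac dp); apply/matrixP => j k; rewrite ks_formE.
apply: (dense_smoothC_eq (f := fun x => ks_of (tderiv J) c (pt c x) j k)
  (g := fun x => contract (sigma_of xi (J 0) C) (omega X) c (pt c x) j k)
  dX ac _ _ _ (cod_coord dp)).
- by apply: (ks_of_smooth _ _ ac) => a b; exact: (tderiv_smooth e0 J_smooth).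
- apply: contract_smooth => // a b; [exact: Sw|exact: sigma_of_smooth].
move=> {dp} q Mq dq; rewrite ptK //.
have [z [c' [zc dc' Jc']]] := J_form q Mq.
have hz : holo_chart (J 0) z by case: zc => -[].
have az := proj1 hz.
have dz : dom z q by case: zc => _ [_ <-].
have ksz : ks_of (tderiv J) z q = contract (sigma_of xi (J 0) C) (omega X) z q.
  apply: (momentum_angle_ks zc dz e0 (erefl _) J_smooth J_endo (S := S q)) => //.
  - by move=> t te; apply: J_sqr.
  - by move=> t te; apply: Jc'.
  - exact: J0_adj.
(* Both forms change chart by the same rule, so the equality in [z] yields that in [c] after
   cancelling the conjugate Jacobian. *)
have ks_tr := ks_of_transform J0_endo hz hc dz dq (tderiv_transform e0 J_smooth J_endo az ac dz dq).
have co_tr := contract_transform J0_endo hz hc dz dq (w_id z c q az ac dz dq)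
  (sigma_of_transform xi J0_endo C hz hc dz dq).
rewrite -ksz -ks_tr in co_tr.
have Hu : (map_mx conjc (holo_jac z c q))^T \in unitmx.
  by rewrite unitmx_tr map_unitmx (holo_jac_unit J0_endo hz hc dz dq).
by have := f_equal (mulmx (invmx (map_mx conjc (holo_jac z c q))^T)) co_tr;
  rewrite !mulKmx // => ->.
Qed.

Theorem proposition5 (R : realType) (m : nat) (X : toricManifold R m)
    (xi : 'M[R]_m) (xi_basis : xi \in unitmx)
    (Mring_dense : dense (Mring X))
    (S : X -> 'M[R]_m) (C : 'M[R]_m) (C_antisym : C^T = - C)
    (e : R) (e_gt0 : 0 < e) (J : R -> tensor X)
    (J0_kahler : KK (J 0))
    (J_DGK : forall t, `|t| < e -> DGK xi (J t))
    (J_smooth : smooth_family e J)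
    (J_form : momentum_angle_deformation xi e J S C) :
  let sigma := sigma_of xi (J 0) C in
  [/\ holomorphic_poisson (J 0) sigma,
      cocycle01 (J 0) (ks_form J),
      cocycle01 (J 0) (contract sigma (omega X)) &
      dolbeault_class (J 0) (ks_form J)
      = dolbeault_class (J 0) (contract sigma (omega X))].
Proof.
move=> sigma.
have ksE := ks_form_eq_contract Mring_dense C_antisym e_gt0 J0_kahler J_DGK J_smooth J_form.
have [[[[_ J0_endo] _] J0_inv _ _ _] J0_adj] := J0_kahler.
have [Sw w_id _ _] := omega_symplectic X.
have sigma_poisson : holomorphic_poisson (J 0) sigma by exact: sigma_of_poisson.
have [sigma_smooth sigma_tr _ sigma_holo _] := sigma_poisson.
have contract_cocycle : cocycle01 (J 0) (contract sigma (omega X)).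
  split; first split.
  - by move=> c hc j k; apply: contract_smooth; [case: hc|apply: Sw; case: hc|apply: sigma_smooth].
  - move=> c c' p hc hc' dp dp'.
    apply: (contract_transform J0_endo hc hc' dp dp'); last exact: sigma_tr.
    by apply: (w_id c c' p (proj1 hc) (proj1 hc') dp dp').
  - move=> c p j k l hc dp.
    apply: (contract_dbar_closed _ _ _ (omega_symplectic X) hc dp).
    + by move=> q dq; apply: J0_adj => //; case: hc.
    + exact: sigma_smooth.
    + by move=> r a b; apply: sigma_holo.
split=> //.
(* The two forms are equal on the domains of holomorphic charts only, so each cocycle condition is
   transferred separately. *)
- have [[c_smooth c_tr] c_closed] := contract_cocycle.
  split; first split.
  - move=> c hc j k; apply: smoothC_ext (c_smooth c hc j k) => x cx.
    by rewrite ksE //; apply: dom_pt => //; case: hc.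
  - by move=> c c' p hc hc' dp dp'; rewrite !ksE //; apply: c_tr.
  - move=> c p j k l hc dp; have ac := proj1 hc.
    have E r a b : wirtb r (fun x => ks_form J c (pt c x) a b) (coord c p) =
        wirtb r (fun x => contract sigma (omega X) c (pt c x) a b) (coord c p).
      rewrite wirtbE [RHS]wirtbE; apply: (wirt_of_ext _ _ (cod_open ac) (cod_coord dp)) => x cx.
      by rewrite ksE //; apply: dom_pt.
    by apply: etrans (E l j k) (etrans _ (esym (E j l k))); apply: c_closed.
(* The same section [v] witnesses membership in both cosets. *)
- apply/seteqP; split=> b [b_cocycle [v v_sec bE]]; split=> //; exists v => // c p hc dp.
    by rewrite bE // ksE.
  by rewrite bE // -ksE.
Qed.
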